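(* Let $k\in\mathbb{N}$ and let $f:(\mathbb{A}_{+})^k\rightarrow\mathbb{C}$ be an arithmetic function. Assume that $$\sum_{G_1,\ldots,G_k\in\mathbb{A}_{+}}2^{\omega(G_1)+\cdots+\omega(G_k)}\frac{|(\mu_{k}\ast f)(G_1,\ldots,G_k)|}{|G_1|\cdots|G_k|}<\infty.$$ Then, for any $G_1,\ldots,G_k\in\mathbb{A}_{+}$, we have $$f(G_1,\ldots,G_k)=\sum_{H_1,\ldots,H_k\in\mathbb{A}_{+}}\mathcal{C}_{H_1,\ldots,H_k}\,\eta(G_1,H_1)\cdots\eta(G_k,H_k)$$ and $$f(G_1,\ldots,G_k)=\sum_{H_1,\ldots,H_k\in\mathbb{A}_{+}}\mathcal{C}^{\ast}_{H_1,\ldots,H_k}\,\eta^{\ast}(G_1,H_1)\cdots\eta^{\ast}(G_k,H_k),$$ where $$\mathcal{C}_{H_1,\ldots,H_k}=\sum_{M_1,\ldots,M_k\in\mathbb{A}_{+}}\frac{(\mu_{k}\ast f)(M_1H_1,\ldots,M_kH_k)}{|M_1H_1|\cdots|M_kH_k|},$$ $$\mathcal{C}^{\ast}_{H_1,\ldots,H_k}=\sum_{\substack{M_1,\ldots,M_k\in\mathbb{A}_{+}\\(M_1,H_1)=1,\ldots,(M_k,H_k)=1}}\frac{(\mu_{k}\ast f)(M_1H_1,\ldots,M_kH_k)}{|M_1H_1|\cdots|M_kH_k|}.$$ Both expansions of $f(G_1,\ldots,G_k)$ (as series over $(H_1,\ldots,H_k)\in(\mathbb{A}_+)^k$) are absolutely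 convergent.
   Context: $\mathbb{N}$ is the set of positive integers. $q=p^n$ is a power of a prime $p$, $\mathbb{A}=\mathbb{F}_q[T]$, $\mathbb{A}_+$ is the set of monic polynomials in $\mathbb{A}$, and $|G|=q^{\deg G}$ for nonzero $G\in\mathbb{A}$. Divisors are always monic; $(G,H)$ is the monic greatest common divisor. A monic $D$ is a unitary divisor of $G$, written $D\|G$, if $D\mid G$ and $(D,G/D)=1$. $(D,H)_\ast$ denotes the element of highest degree in the set of monic $D'$ with $D'\mid D$ and $D'\|H$. $\omega(G)$ is the number of distinct monic irreducible divisors of $G$. An arithmetic function of $k$ variables is a function $f:(\mathbb{A}_+)^k\to\mathbb{C}$ that is not identically zero. Dirichlet convolution: $(f\ast g)(G_1,\ldots,G_k)=\sum_{D_1|G_1,\ldots,D_k|G_k}f(D_1,\ldots,D_k)\,g(G_1/D_1,\ldots,G_k/D_k)$, sums over monic divisors. $\mu$ is the Möbius function on $\mathbb{A}$: $\mu(G)=0$ if $G$ is not square-free and $\mu(G)=(-1)^t$ if $G$ is a constant times a product of $t$ distinct monic irreducibles. $\mu_k(G_1,\ldots,G_k)=\mu(G_1)\cdots\mu(G_k)$. (Unitary) polynomial Ramanujan sums: let $H\in\mathbb{A}$ be nonzero of degree $m$. For $A\in\mathbb{A}$ let $t(A)\in\mathbb{F}_q$ be the coefficient of $T^{m-1}$ in the remainder of $A$ modulo $H$ (so $t=0$ if $m=0$). For $G,A\in\mathbb{A}$ put $E(G,H)(A)=\exp\left(2\pi i\,\mathrm{tr}(t(GA))/p\right)$, where $\mathrm{tr}$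 is the trace from $\mathbb{F}_q$ to $\mathbb{F}_p$. Then $$\eta(G,H)=\sum_{D\bmod H,\ (D,H)=1}E(G,H)(D),\qquad \eta^{\ast}(G,H)=\sum_{D\bmod H,\ (D,H)_\ast=1}E(G,H)(D),$$ sums over a complete residue system modulo $H$. *)

(* Defs.v *)
From HB Require Import structures.
From mathcomp Require Export all_boot all_order all_algebra all_field.
From mathcomp Require Export finmap complex.
From mathcomp Require Export all_classical all_reals all_analysis.

Set Implicit Arguments.
Unset Strict Implicit.
Unset Printing Implicit Defensive.

Import Order.TTheory GRing.Theory Num.Theory.
Local Open Scope classical_set_scope.
Local Open Scope ring_scope.
Local Open Scope complex_scope.

(* Convergence of the finite partial sums along the finite subsets of [D],
   directed by inclusion. *)
Definition sums_to (R : realType) (I : choiceType) (D : set I)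
    (u : I -> R[i]) (s : R[i]) : Prop :=
  forall e : R, 0 < e -> exists2 X : {fset I}, [set` X] `<=` D &
    forall Y : {fset I}, [set` X] `<=` [set` Y] -> [set` Y] `<=` D ->
      `|\sum_(i <- Y) u i - s| < e%:C.

(* Junk value 0 when the series does not converge. *)
Definition csum (R : realType) (I : choiceType) (D : set I) (u : I -> R[i]) :
    R[i] :=
  xget 0 [set s | sums_to D u s].

Definition abs_summable (R : realType) (I : choiceType) (D : set I)
    (u : I -> R[i]) : Prop :=
  (\esum_(i in D) (Normc.normc (u i))%:E < +oo)%E.

Record Aplus (F : finFieldType) :=
  MkAplus { Aplus_val :> {poly F}; _ : Aplus_val \is monic }.

HB.instance Definition _ (F : finFieldType) := [isSub for @Aplus_val F].
HB.instance Definition _ (F : finFieldType) := [Choice of Aplus F by <:].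

Lemma Aplus_monic (F : finFieldType) (G : Aplus F) : (G : {poly F}) \is monic.
Proof. by case: G. Qed.

Lemma Aplus_mul_monic (F : finFieldType) (G H : Aplus F) :
  (G : {poly F}) * H \is monic.
Proof. by rewrite monicMl Aplus_monic. Qed.

Definition Aplus1 (F : finFieldType) : Aplus F := MkAplus (monic1 F).

Definition Aplus_mul (F : finFieldType) (G H : Aplus F) : Aplus F :=
  MkAplus (Aplus_mul_monic G H).

(* The default value 1 is never used when [D] divides [G]: see
   [Aplus_mulKdiv]. *)
Definition Aplus_div (F : finFieldType) (G D : Aplus F) : Aplus F :=
  insubd (Aplus1 F) ((G : {poly F}) %/ D).

Lemma Aplus_mulKdiv (F : finFieldType) (G D : Aplus F) :
  (D : {poly F}) %| G -> Aplus_mul (Aplus_div G D) D = G.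
Proof.
move=> /divpK GD; apply: val_inj => /=; rewrite insubdK ?GD//.
rewrite -topredE/= -(monicMl _ (Aplus_monic D)).
by rewrite mulrC GD Aplus_monic.
Qed.

Definition pnorm (F : finFieldType) (G : {poly F}) : nat :=
  (#|F| ^ (size G).-1)%N.

Definition unitary_dvdp (F : finFieldType) (D G : {poly F}) : bool :=
  (D %| G) && coprimep D (G %/ D).

(* [(D, H)_*]; see [ugcdP] and [ugcd_unique]. *)
Definition ugcd (F : finFieldType) (D H : {poly F}) : Aplus F :=
  xget (Aplus1 F)
    [set D' : Aplus F | [/\ (D' : {poly F}) %| D, unitary_dvdp D' H &
      forall D'' : Aplus F, (D'' : {poly F}) %| D -> unitary_dvdp D'' H ->
        (size D'' <= size D')%N]].

Definition omega (F : finFieldType) (G : Aplus F) : nat :=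
  #|` fset_set [set P : Aplus F | irreducible_poly P /\ (P : {poly F}) %| G]|%fset.

Definition squarefree (F : finFieldType) (G : {poly F}) : Prop :=
  forall D : {poly F}, D ^+ 2 %| G -> (size D <= 1)%N.

(* A square-free monic polynomial is the product of its [omega G] distinct
   monic irreducible divisors. *)
Definition mobius (F : finFieldType) (G : Aplus F) : int :=
  if `[< squarefree G >] then (-1) ^+ omega G else 0.

Notation tuples k F := {ffun 'I_k -> Aplus F}.

Definition tuple_mul (F : finFieldType) (k : nat) (M H : tuples k F) :
    tuples k F :=
  [ffun i => Aplus_mul (M i) (H i)].

Definition tuple_div (F : finFieldType) (k : nat) (G D : tuples k F) :
    tuples k F :=
  [ffun i => Aplus_div (G i) (D i)].

Definition tuple_divisors (F : finFieldType) (k : nat) (G : tuples k F) :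
    set (tuples k F) :=
  [set D : tuples k F | forall i, (D i : {poly F}) %| G i].

Definition tuple_norm (F : finFieldType) (k : nat) (G : tuples k F) : nat :=
  (\prod_(i < k) pnorm (G i))%N.

Definition mobius_k (R : realType) (F : finFieldType) (k : nat)
    (G : tuples k F) : R[i] :=
  \prod_(i < k) (mobius (G i))%:~R.

Definition dirichlet (R : realType) (F : finFieldType) (k : nat)
    (f g : tuples k F -> R[i]) (G : tuples k F) : R[i] :=
  \sum_(D \in tuple_divisors G) (f D * g (tuple_div G D)).

(* The trace from [F] to its prime field, as an element of ['F_p]; see
   [FpTraceP]. *)
Definition FpTrace (F : finFieldType) (p : nat) (charFp : p \in [pchar F])
    (x : F) : 'F_p :=
  let L := pPrimeCharType charFp in
  odflt 0 [pick a : 'F_p | a%:A == galTrace 1%VS {:L} (x : L)].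

(* The coefficient of degree [m - 1] where [m] is the degree of [H]; for [m = 0]
   the remainder, hence the coefficient, is 0. *)
Definition char_coef (F : finFieldType) (H A : {poly F}) : F :=
  (A %% H)`_(size H).-2.

(* [exp (2 pi i tr (t (G A)) / p)] *)
Definition add_char (R : realType) (F : finFieldType) (p : nat)
    (charFp : p \in [pchar F]) (G H A : {poly F}) : R[i] :=
  let theta :=
    2 * pi * (FpTrace charFp (char_coef H (G * A)) : nat)%:R / p%:R in
  cos theta +i* sin theta.

(* The polynomials of degree less than the degree of [H], that is the elements
   of [{poly_(size H).-1 F}], serve as complete residue system modulo [H]. *)
Definition eta (R : realType) (F : finFieldType) (p : nat)
    (charFp : p \in [pchar F]) (G H : {poly F}) : R[i] :=
  \sum_(D : {poly_((size H).-1) F} | coprimep D H) add_char R charFp G H D.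

Definition eta_star (R : realType) (F : finFieldType) (p : nat)
    (charFp : p \in [pchar F]) (G H : {poly F}) : R[i] :=
  \sum_(D : {poly_((size H).-1) F} | ugcd D H == Aplus1 F)
     add_char R charFp G H D.

Definition coef_term (R : realType) (F : finFieldType) (k : nat)
    (f : tuples k F -> R[i]) (H M : tuples k F) : R[i] :=
  dirichlet (@mobius_k R F k) f (tuple_mul M H)
    / (tuple_norm (tuple_mul M H))%:R.

Definition tuple_coprime (F : finFieldType) (k : nat) (H : tuples k F) :
    set (tuples k F) :=
  [set M : tuples k F | forall i, coprimep (M i) (H i)].

Definition ramanujan_coef (R : realType) (F : finFieldType) (k : nat)
    (f : tuples k F -> R[i]) (H : tuples k F) : R[i] :=
  csum setT (coef_term f H).

Definition ramanujan_coef_star (R : realType) (F : finFieldType) (k : nat)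
    (f : tuples k F -> R[i]) (H : tuples k F) : R[i] :=
  csum (tuple_coprime H) (coef_term f H).

Lemma sums_to_unique (R : realType) (I : choiceType) (D : set I)
    (u : I -> R[i]) (s t : R[i]) :
  sums_to D u s -> sums_to D u t -> s = t.
Proof.
move=> us ut; apply/eqP; rewrite -subr_eq0 -normr_le0.
rewrite normc_def lecR leNgt; apply/negP => st.
pose e := Num.sqrt (complex.Re (s - t) ^+ 2 + complex.Im (s - t) ^+ 2).
have e2 : 0 < e / 2 by rewrite divr_gt0.
have [X XD uX] := us _ e2; have [Y YD uY] := ut _ e2.
have XYD : [set` (X `|` Y)%fset] `<=` D.
  by move=> i /=; rewrite inE => /orP[/XD|/YD].
have := uX (X `|` Y)%fset _ XYD; have := uY (X `|` Y)%fset _ XYD.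
set v := \sum_(i <- _) _.
move=> vt vs.
have : `|s - t| < (e / 2)%:C + (e / 2)%:C.
  rewrite -(subrKA v) (le_lt_trans (ler_normD _ _))// ltrD//.
    by rewrite distrC vs // => i /= iX; rewrite inE iX.
  by rewrite vt // => i /= iY; rewrite inE iY orbT.
by rewrite normc_def -rmorphD ltcR -splitr ltxx.
Qed.

Lemma csumE (R : realType) (I : choiceType) (D : set I) (u : I -> R[i])
    (s : R[i]) :
  sums_to D u s -> csum D u = s.
Proof.
move=> us; rewrite /csum; case: xgetP => [t _ ut|/(_ s)//].
exact: sums_to_unique ut us.
Qed.

Lemma size_divisor (F : finFieldType) (G : Aplus F) (D : {poly F}) :
  D %| G -> (size D <= size G)%N.
Proof. by move=> /dvdp_leq; apply; rewrite monic_neq0 ?Aplus_monic. Qed.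

Lemma finite_tuple_divisors (F : finFieldType) (k : nat) (G : tuples k F) :
  finite_set (tuple_divisors G).
Proof.
pose n := (\max_(i < k) size (G i))%N.
pose g (h : {ffun 'I_k -> {poly_n F}}) : tuples k F :=
  [ffun i => insubd (Aplus1 F) (h i : {poly F})].
apply: (@sub_finite_set _ _ (g @` setT)); last first.
  exact/finite_image/finite_finset.
move=> D DG; exists [ffun i => npolyp n (D i)] => //.
apply/ffunP => i; rewrite /g !ffunE npolypK ?valKd//.
rewrite (leq_trans (size_divisor (DG i)))//.
exact: (leq_bigmax (F := fun i => size (G i))).
Qed.

Lemma finite_divisors (F : finFieldType) (G : Aplus F) :
  finite_set [set D : Aplus F | (D : {poly F}) %| G].
Proof.
have := finite_image (fun D : tuples 1 F => D ord0)
  (finite_tuple_divisors [ffun=> G]).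
apply: sub_finite_set => D /= DG; exists [ffun=> D]; rewrite ?ffunE// => i.
by rewrite !ffunE.
Qed.

Lemma omegaE (F : finFieldType) (G : Aplus F) (P : Aplus F) :
  (P \in fset_set [set P : Aplus F | irreducible_poly P /\
                     (P : {poly F}) %| G]) <->
  irreducible_poly P /\ (P : {poly F}) %| G.
Proof.
rewrite in_fset_set ?inE//.
by apply: sub_finite_set (finite_divisors G) => Q [].
Qed.

Lemma ugcdP (F : finFieldType) (D : {poly F}) (H : Aplus F) :
  [/\ (ugcd D H : {poly F}) %| D, unitary_dvdp (ugcd D H) H &
    forall D' : Aplus F, (D' : {poly F}) %| D -> unitary_dvdp D' H ->
      (size D' <= size (ugcd D H))%N].
Proof.
rewrite /ugcd; case: xgetP => [//|noD]; exfalso.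
pose P n := `[< exists D' : Aplus F,
  [/\ (D' : {poly F}) %| D, unitary_dvdp D' H & size D' = n] >].
have P1 : exists n, P n.
  exists 1%N; apply/asboolP; exists (Aplus1 F) => /=.
  by rewrite /unitary_dvdp !dvd1p coprime1p size_poly1.
have Pmax n : P n -> (n <= size H)%N.
  by move=> /asboolP[D' [_ /andP[/size_divisor ? _] <-]].
case: (ex_maxnP P1 Pmax) => n /asboolP[D' [D'D D'H szD']] nmax.
apply: (noD D'); split=> // E ED EH; rewrite szD'; apply: nmax.
by apply/asboolP; exists E.
Qed.

Lemma ugcd_unique (F : finFieldType) (D : {poly F}) (H D' : Aplus F) :
  (D' : {poly F}) %| D -> unitary_dvdp D' H -> size D' = size (ugcd D H) ->
  D' = ugcd D H.
Proof.
case: (ugcdP D H); set E := ugcd D H => ED EH Emax D'D D'H szD'.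
have H0 : (H : {poly F}) != 0 by rewrite monic_neq0 ?Aplus_monic.
have D'0 : (D' : {poly F}) != 0 by rewrite monic_neq0 ?Aplus_monic.
have E0 : (E : {poly F}) != 0 by rewrite monic_neq0 ?Aplus_monic.
pose g := gcdp D' E; pose D1 := (D' : {poly F}) %/ g; pose E1 := (E : {poly F}) %/ g.
have g0 : g != 0 by rewrite gcdp_eq0 negb_and D'0.
have D'E : (D' : {poly F}) = D1 * g by rewrite divpK ?dvdp_gcdl.
have EE : (E : {poly F}) = E1 * g by rewrite divpK ?dvdp_gcdr.
have cop : coprimep E1 D1 by rewrite coprimep_sym coprimep_div_gcd ?D'0.
have D10 : D1 != 0 by apply: contra_neq D'0 => D10; rewrite D'E D10 mul0r.
have E10 : E1 != 0 by apply: contra_neq E0 => E10; rewrite EE E10 mul0r.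
have lcmP X : (D' : {poly F}) %| X -> (E : {poly F}) %| X ->
    (D' : {poly F}) * E1 %| X.
  move=> /dvdpP[A ->]; rewrite D'E EE mulrA dvdp_mul2r//.
  rewrite (Gauss_dvdpl _ cop) => E1A.
  by rewrite mulrAC dvdp_mul2r// mulrC dvdp_mul2r.
have /andP[D'dH copD'] := D'H; have /andP[EdH copE] := EH.
pose c := (lead_coef ((D' : {poly F}) * E1))^-1.
have c0 : c != 0 by rewrite invr_eq0 lead_coef_eq0 mulf_neq0.
have Lmonic : c *: ((D' : {poly F}) * E1) \is monic.
  by rewrite monicE lead_coefZ mulVf// lead_coef_eq0 mulf_neq0.
pose L := MkAplus Lmonic.
have LP X : (D' : {poly F}) %| X -> (E : {poly F}) %| X -> (L : {poly F}) %| X.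
  by move=> D'X EX; rewrite dvdpZl// lcmP.
have D'L : (D' : {poly F}) %| L by rewrite dvdpZr// dvdp_mulr.
have EL : (E : {poly F}) %| L.
  by rewrite dvdpZr// D'E EE mulrAC dvdp_mul2r// dvdp_mull.
have szL : (size L <= size E)%N.
  apply: Emax; first exact: LP.
  rewrite /unitary_dvdp LP//=.
  have HL : (H : {poly F}) = H %/ L * L by rewrite divpK ?LP.
  have quo A : (A : {poly F}) %| L -> A != 0 -> (H %/ L) %| (H %/ A).
    move=> /dvdpP[B LB] A0; apply/dvdpP; exists B.
    by rewrite {1}HL LB mulrA mulpK// mulrC.
  rewrite coprimepZl// coprimepMl (coprimep_dvdl (quo _ D'L D'0))//=.
  apply: coprimep_dvdr (_ : E1 %| E) _; first by rewrite EE dvdp_mulr.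
  by apply: coprimep_dvdl (quo _ EL E0) _.
have monic_eq (A : Aplus F) : (A : {poly F}) %| L -> size A = size E -> A = L.
  move=> AL szA; apply: val_inj; apply/eqP.
  rewrite -eqp_monic ?Aplus_monic// -dvdp_size_eqp// eqn_leq dvdp_leq//=.
    by rewrite szA.
  by rewrite monic_neq0 ?Aplus_monic.
by rewrite (monic_eq _ D'L szD') (monic_eq _ EL).
Qed.

Lemma FpTraceP (F : finFieldType) (p : nat) (charFp : p \in [pchar F]) (x : F) :
  (FpTrace charFp x)%:A
    = galTrace 1%VS {: pPrimeCharType charFp} (x : pPrimeCharType charFp).
Proof.
rewrite /FpTrace; case: pickP => [a /eqP//|noa].
have /vlineP[a ax] : galTrace 1%VS {: pPrimeCharType charFp}
    (x : pPrimeCharType charFp) \in 1%VS.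
  by rewrite mem_galTrace ?memvf// finField_galois ?sub1v.
by have := noa a; rewrite ax eqxx.
Qed.

(* Main.v *)
Require Import Defs.
From mathcomp Require Import all_boot all_order all_algebra all_field.
From mathcomp Require Import finmap complex.
From mathcomp Require Import all_classical all_reals all_analysis.

Set Implicit Arguments.
Unset Strict Implicit.
Unset Printing Implicit Defensive.

Import Order.TTheory GRing.Theory Num.Theory.
Local Open Scope classical_set_scope.
Local Open Scope ring_scope.
Local Open Scope complex_scope.

(** The expansions come from one identity for each kind of Ramanujan sum: the sum
    of [eta G H] over all the divisors [H] of [N], and the sum of [eta_star G H]
    over the unitary divisors [H] of [N], are both equal to the norm of [N] if [N]
    divides [G] and to 0 otherwise ([sum_ramanujan_sum]).  Write [g] for the
    convolution of [mobius_k] with [f].  Moebius inversion gives [f G] as the sum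
    of [g N] over the divisors [N] of [G] ([sum_dirichlet_mobius_k]), that is, by
    the identity, as the sum of [g N / |N|] times the product of the
    [eta (G i) (H i)] over all pairs [(M, H)] with [MH = N], and over all [N].
    Grouping the pairs by [H] instead of by [MH] does not change the value of the
    sum, and turns it into the expansion.  In the unitary case the pairs are
    restricted to coprime [M i] and [H i].

    The interchange is legitimate because the family over the pairs is absolutely
    summable: the sum of [|eta G H|] over the divisors [H] of [N] is at most
    [2 ^ omega N] times the sum of the norms of the divisors of [G]
    ([sum_normc_ramanujan_sum]), so that the hypothesis applies
    ([pair_term_summable]).  Fubini's theorem for unconditional sums is
    [sums_to_fibres].

    Both facts on Ramanujan sums result from writing them as convolutions of a
    Moebius function with the complete character sums ([ramanujan_sumE]).  The
    complete sums are evaluated by the orthogonality relation [sum_add_char],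
    which rests on the nonvanishing of the trace.  The Moebius functions enter
    through [sum_moebius], a cancellation proved by inserting or removing a fixed
    prime, and through the bound on the number of divisors at which they do not
    vanish, [sum_abs_moebius].

    A boolean [star] treats the ordinary and the unitary theory at once: it
    selects the admissible factorizations of a polynomial, all of them or those
    into coprime factors. *)

(** * Unconditional summation of complex families *)

Section ComplexModulus.
Variable R : realType.
Implicit Types x y z : R[i].

Lemma norm_normc z : `|z| = (Normc.normc z)%:C.
Proof. by rewrite normc_def; case: z. Qed.

Lemma normc_ge0 z : 0 <= Normc.normc z.
Proof. by rewrite -lecR -norm_normc normr_ge0. Qed.

Lemma ler_normcD x y : Normc.normc (x + y) <= Normc.normc x + Normc.normc y.
Proof. by rewrite -lecR rmorphD /= -!norm_normc ler_normD. Qed.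

Lemma normcBC x y : Normc.normc (x - y) = Normc.normc (y - x).
Proof.
by apply: (fmorph_inj (real_complex R)); rewrite /= -!norm_normc distrC.
Qed.

Lemma normc_ge_abs_Re z : `|complex.Re z| <= Normc.normc z.
Proof. by rewrite -lecR -norm_normc normc_ge_Re. Qed.

Lemma normc_ge_abs_Im z : `|complex.Im z| <= Normc.normc z.
Proof.
case: z => a b /=; rewrite -(ler_sqr (normr_ge0 _) (sqrtr_ge0 _)).
by rewrite sqr_sqrtr ?addr_ge0 ?sqr_ge0// real_normK ?num_real// lerDr sqr_ge0.
Qed.

Lemma ler_normc_sum (I : Type) (r : seq I) (P : pred I) (u : I -> R[i]) :
  Normc.normc (\sum_(i <- r | P i) u i) <= \sum_(i <- r | P i) Normc.normc (u i).
Proof.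
by rewrite -lecR -norm_normc rmorph_sum; apply: ler_norm_sum.
Qed.

Lemma normc_prod (I : Type) (r : seq I) (P : pred I) (u : I -> R[i]) :
  Normc.normc (\prod_(i <- r | P i) u i)
    = \prod_(i <- r | P i) Normc.normc (u i).
Proof.
apply: (big_morph (@Normc.normc R)); last exact: Normc.normc1.
exact: Normc.normcM.
Qed.

Lemma normc_real (x : R) : Normc.normc x%:C = `|x|.
Proof. by rewrite /= expr0n /= addr0 sqrtr_sqr. Qed.

Lemma normc_nat n : Normc.normc (n%:R : R[i]) = n%:R.
Proof.
by rewrite -[n%:R](rmorph_nat (real_complex R)) normc_real ger0_norm ?ler0n.
Qed.

End ComplexModulus.

Section Summation.
Variables (R : realType) (I : choiceType).
Implicit Types (D : set I) (u : I -> R[i]).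

Lemma sums_toP D u s :
  sums_to D u s <-> forall e : R, 0 < e -> exists2 X : {fset I}, [set` X] `<=` D &
    forall Y : {fset I}, [set` X] `<=` [set` Y] -> [set` Y] `<=` D ->
      Normc.normc (\sum_(i <- Y) u i - s) < e.
Proof.
by split=> us e e0; have [X XD uX] := us e e0; exists X => // Y XY YD;
  have := uX Y XY YD; rewrite norm_normc ltcR.
Qed.

Lemma esum_ltyP D (a : I -> R) : (forall i, 0 <= a i) ->
  (\esum_(i in D) (a i)%:E < +oo)%E <->
  exists B : R, forall X : {fset I}, [set` X] `<=` D -> \sum_(i <- X) a i <= B.
Proof.
move=> a0; split=> [fin|[B aB]].
- exists (fine (\esum_(i in D) (a i)%:E)) => X XD.
  rewrite -lee_fin fineK.
    apply: ereal_sup_ubound; exists [set` X]; first by split.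
    by rewrite fsbig_finite//= set_fsetK -sumEFin.
  rewrite ge0_fin_numE//; apply: esum_ge0 => i _; rewrite lee_fin.
  exact: a0.
- apply: le_lt_trans (ltry B); apply: ge_ereal_sup => _ [A [finA AD] <-].
  rewrite fsbig_finite//= sumEFin lee_fin; apply: aB => i /=.
  by rewrite in_fset_set// inE => /AD.
Qed.

Lemma abs_summableP D u :
  abs_summable D u <->
  exists B : R, forall X : {fset I}, [set` X] `<=` D ->
    \sum_(i <- X) Normc.normc (u i) <= B.
Proof. by apply: esum_ltyP => i; apply: normc_ge0. Qed.

Lemma sub_abs_summable D D' u :
  D `<=` D' -> abs_summable D' u -> abs_summable D u.
Proof.
move=> DD' /abs_summableP[B uB]; apply/abs_summableP; exists B => X XD.
by apply: uB; apply: subset_trans XD DD'.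
Qed.

Lemma ler_sum_fset (a : I -> R) (X Y : {fset I}) :
  (forall i, 0 <= a i) -> [set` X] `<=` [set` Y] ->
  \sum_(i <- X) a i <= \sum_(i <- Y) a i.
Proof.
move=> a0 XY; rewrite [leRHS](bigID (mem X))/=.
rewrite -[leLHS]addr0 lerD ?sumr_ge0//.
rewrite -[X in _ <= X]big_filter le_eqVlt; apply/orP; left; apply/eqP.
apply: perm_big; apply: uniq_perm => [||i]; rewrite ?filter_uniq//.
rewrite mem_filter; case: (boolP (i \in X)) => //= iX.
by have /= -> := XY i iX.
Qed.

(** The increasing net of the partial sums converges to its supremum; this is
    where completeness of the reals enters. *)
Lemma ge0_bounded_sums_to D (a : I -> R) (B : R) :
  (forall i, 0 <= a i) ->
  (forall X : {fset I}, [set` X] `<=` D -> \sum_(i <- X) a i <= B) ->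
  exists s, sums_to D (fun i => (a i)%:C) s%:C.
Proof.
move=> a0 aB.
pose S := [set \sum_(i <- X) a i | X in [set X : {fset I} | [set` X] `<=` D]].
have supS : has_sup S.
  split; first by exists (\sum_(i <- (fset0 : {fset I})) a i); exists fset0.
  by exists B => _ [X XD <-]; apply: aB.
exists (sup S); apply/sums_toP => e e0.
have [_ [X XD <-] ltX] := sup_adherent e0 supS.
exists X => // Y XY YD.
rewrite -rmorph_sum -rmorphB normc_real distrC ger0_norm; last first.
  by rewrite subr_ge0; apply: ub_le_sup; [exact: supS.2|exists Y].
by rewrite ltrBlDr addrC -ltrBlDr (lt_le_trans ltX)// ler_sum_fset.
Qed.

Lemma sums_toD D u v s t :
  sums_to D u s -> sums_to D v t -> sums_to D (fun i => u i + v i) (s + t).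
Proof.
move=> /sums_toP us /sums_toP vt; apply/sums_toP => e e0.
have e2 : 0 < e / 2 by rewrite divr_gt0.
have [X XD uX] := us _ e2; have [Y YD vY] := vt _ e2.
exists (X `|` Y)%fset => [i /=|Z XYZ ZD]; first by rewrite inE => /orP[/XD|/YD].
rewrite big_split/= opprD addrACA (le_lt_trans (ler_normcD _ _))//.
rewrite [ltRHS]splitr ltrD// ?uX ?vY// => i /= iX; apply: XYZ => /=.
  by rewrite inE iX.
by rewrite inE iX orbT.
Qed.

Lemma sums_toZ D u s (c : R[i]) :
  sums_to D u s -> sums_to D (fun i => c * u i) (c * s).
Proof.
move=> /sums_toP us; apply/sums_toP => e e0.
have c0 : 0 < Normc.normc c + 1 by rewrite ltr_wpDl ?normc_ge0.
have [X XD uX] := us _ (divr_gt0 e0 c0).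
exists X => // Y XY YD; rewrite -mulr_sumr -mulrBr Normc.normcM.
have := uX Y XY YD; rewrite ltr_pdivlMr//; apply: le_lt_trans.
by rewrite mulrC ler_wpM2l ?normc_ge0// lerDl.
Qed.

Lemma eq_sums_to D u v s :
  (forall i, D i -> u i = v i) -> sums_to D u s -> sums_to D v s.
Proof.
move=> uv us e e0; have [X XD uX] := us e e0; exists X => // Y XY YD.
rewrite -(_ : \sum_(i <- Y) u i = \sum_(i <- Y) v i) ?uX//.
by apply: eq_big_seq => i iY; apply/uv/YD.
Qed.

(** A real family is the difference of the nonnegative families [|a| + a] and
    [|a|]. *)
Lemma real_bounded_sums_to D (a : I -> R) (B : R) :
  (forall X : {fset I}, [set` X] `<=` D -> \sum_(i <- X) `|a i| <= B) ->
  exists s, sums_to D (fun i => (a i)%:C) s.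
Proof.
move=> aB.
have [s sP] := ge0_bounded_sums_to (fun i => normr_ge0 (a i)) aB.
have a0 i : 0 <= `|a i| + a i by rewrite -lerBlDl sub0r lerNnormlW.
have [|t tP] := @ge0_bounded_sums_to D _ (B + B) a0.
  move=> X XD; rewrite big_split/= lerD ?aB//.
  by rewrite (le_trans _ (aB X XD))// ler_sum// => i _; rewrite ler_norm.
exists (t%:C + -1 * s%:C).
apply: eq_sums_to (sums_toD tP (sums_toZ (-1) sP)) => i _.
by rewrite mulN1r -rmorphB/= addrAC subrr add0r.
Qed.

Lemma abs_summable_sums_to D u :
  abs_summable D u -> exists s, sums_to D u s.
Proof.
move=> /abs_summableP[B uB].
have [|s sP] := @real_bounded_sums_to D (fun i => complex.Re (u i)) B.
  move=> X /uB; apply: le_trans; apply: ler_sum => i _.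
  exact: normc_ge_abs_Re.
have [|t tP] := @real_bounded_sums_to D (fun i => complex.Im (u i)) B.
  move=> X /uB; apply: le_trans; apply: ler_sum => i _.
  exact: normc_ge_abs_Im.
exists (s + 'i * t); apply: eq_sums_to (sums_toD sP (sums_toZ 'i tP)) => i _.
by rewrite [RHS]complexE.
Qed.

Lemma abs_summable_csum D u :
  abs_summable D u -> sums_to D u (csum D u).
Proof. by move=> /abs_summable_sums_to[s us]; rewrite (csumE us). Qed.

Lemma sums_to_finite_support D u (X : {fset I}) :
  [set` X] `<=` D -> (forall i, D i -> i \notin X -> u i = 0) ->
  sums_to D u (\sum_(i <- X) u i).
Proof.
move=> XD u0; apply/sums_toP => e e0; exists X => // Y XY YD.
suff -> : \sum_(i <- Y) u i = \sum_(i <- X) u i by rewrite subrr Normc.normc0.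
apply/esym/big_fset_incl => [|i iY iX]; last by rewrite u0//; apply: YD.
by apply/fsubsetP => i /XY.
Qed.

End Summation.

Lemma sums_to_image (R : realType) (I K : choiceType) (h : I -> K) (h' : K -> I)
    (D : set I) (u : K -> R[i]) (s : R[i]) : cancel h h' ->
  sums_to D (u \o h) s -> sums_to (h @` D) u s.
Proof.
move=> hK /sums_toP us; apply/sums_toP => e e0; have [X XD uX] := us e e0.
exists [fset h i | i in X]%fset => [_ /imfsetP[i /= iX ->]|Y XY YD].
  by exists i => //; apply: XD.
have h'K z : z \in Y -> h (h' z) = z by move=> /YD[i _ <-]; rewrite hK.
rewrite (_ : \sum_(z <- Y) u z = \sum_(i <- [fset h' z | z in Y]%fset) (u \o h) i).
  apply: uX => [i /= iX|_ /imfsetP[z /= /YD[i Di <-] ->]]; last by rewrite hK.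
  by apply/imfsetP; exists (h i); rewrite ?hK//=; apply: XY; apply: in_imfset.
rewrite big_imfset/= => [|x y xY yY /(congr1 h)]; last by rewrite !h'K.
by apply: eq_big_seq => z /h'K ->.
Qed.

Section Fibres.
Variables (R : realType) (I K : choiceType).
Variables (S : set K) (pi : K -> I) (u : K -> R[i]).

Definition fibre i := [set z | S z /\ pi z = i].

Lemma sum_over_fibres (V : nmodType) (w : K -> V) (Y : {fset I}) (Z : {fset K}) :
  (forall z, z \in Z -> pi z \in Y) ->
  \sum_(i <- Y) \sum_(z <- [fset z in Z | pi z == i]%fset) w z
    = \sum_(z <- Z) w z.
Proof.
move=> ZY; transitivity (\sum_(i <- Y) \sum_(z <- Z | pi z == i) w z).
  apply: eq_bigr => i _; rewrite -[RHS]big_filter; apply: perm_big.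
  apply: uniq_perm; rewrite ?filter_uniq// => z.
  by rewrite mem_filter !inE /= andbC.
rewrite (exchange_big_dep predT)/= 1?[LHS](eq_big_seq w)// => z /ZY zY.
rewrite big_mkcond/= (big_fsetD1 _ zY)/= eqxx big1_fset ?addr0// => i.
by rewrite !inE eq_sym => /andP[/negbTE ->].
Qed.

(** As [Y] is finite, one finite set [Z] serves all the fibres over [Y]: take
    the union of the sets that realize the error [e / (#|Y| + 1)] in each fibre.
    Both parts of Fubini's theorem follow, since a sum over [Z] can be grouped
    along [pi]. *)
Lemma fibre_sums_approx (v : I -> R[i]) (Y : {fset I}) (X : {fset K}) (e : R) :
  (forall i, sums_to (fibre i) u (v i)) -> 0 < e ->
  [set` X] `<=` S -> (forall z, z \in X -> pi z \in Y) ->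
  exists Z : {fset K}, [/\ [set` X] `<=` [set` Z], [set` Z] `<=` S,
    forall z, z \in Z -> pi z \in Y &
    \sum_(i <- Y)
      Normc.normc (\sum_(z <- [fset z in Z | pi z == i]%fset) u z - v i) <= e].
Proof.
move=> uv e0 XS XY.
pose d := e / (size Y).+1%:R.
have d0 : 0 < d by rewrite divr_gt0// ltr0n.
have /choice[W WP] : forall i, exists Wi : {fset K}, [set` Wi] `<=` fibre i /\
    forall W' : {fset K}, [set` Wi] `<=` [set` W'] -> [set` W'] `<=` fibre i ->
      Normc.normc (\sum_(z <- W') u z - v i) < d.
  move=> i; have /sums_toP/(_ d d0)[Wi WiS uWi] := uv i.
  by exists Wi; split.
pose Z := (X `|` \bigcup_(i <- Y) W i)%fset.
have inZ z : z \in Z -> S z /\ pi z \in Y.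
  rewrite inE => /orP[zX|/bigfcupP[i /andP[iY _] zW]].
    by split; [exact: XS|exact: XY].
  by have [/(_ z zW)[Sz ->] _] := WP i.
exists Z; split=> [z /= zX|z /= /inZ[]//|z /inZ[]//|]; first by rewrite inE zX.
apply: (@le_trans _ _ (\sum_(i <- Y) d)).
  rewrite big_seq [leRHS]big_seq; apply: ler_sum => i iY; apply/ltW.
  have [WiS uWi] := WP i; apply: uWi => z /= zW.
    have [Sz <-] := WiS z zW; rewrite !inE eqxx andbT; apply/orP; right.
    by apply/bigfcupP; exists i; rewrite ?iY.
  move: zW; rewrite !inE -in_fsetU -/Z => /andP[zZ /eqP].
  by split => //; case: (inZ z zZ).
rewrite big_const_seq count_predT iter_addr_0 -mulr_natr /d.
by rewrite mulrAC ler_pdivrMr ?ltr0n// ler_wpM2l ?ler_nat// ltW.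
Qed.

(** Together with the next lemma this is Fubini's theorem.  Below it is applied
    to the pairs [(M, H)], with [pi] their product [MH] and then with [pi] the
    second projection. *)
Lemma abs_summable_fibres (v : I -> R[i]) :
  abs_summable S u -> (forall i, sums_to (fibre i) u (v i)) ->
  abs_summable setT v.
Proof.
move=> /abs_summableP[B uB] uv; apply/abs_summableP; exists (1 + B) => Y _.
have [] := @fibre_sums_approx v Y fset0 1 uv ltr01 => // Z [_ ZS ZY uZ].
apply: (le_trans _ (lerD uZ (uB Z ZS))).
rewrite -(sum_over_fibres _ ZY) -big_split/=; apply: ler_sum => i _.
set U := [fset z in Z | _]%fset.
rewrite -[X in Normc.normc X](subrK (\sum_(z <- U) u z)) (le_trans (ler_normcD _ _))//.
by rewrite lerD ?ler_normc_sum// normcBC.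
Qed.

Lemma sums_to_fibres (v : I -> R[i]) s :
  (forall i, sums_to (fibre i) u (v i)) -> sums_to S u s -> sums_to setT v s.
Proof.
move=> uv /sums_toP us; apply/sums_toP => e e0.
have e2 : 0 < e / 2 by rewrite divr_gt0.
have [X XS uX] := us _ e2.
exists [fset pi z | z in X]%fset => // Y XY _.
have [] := @fibre_sums_approx v Y X (e / 2) uv e2 XS.
  by move=> z zX; apply: XY; rewrite /= in_imfset.
move=> Z [XZ ZS ZY uZ].
rewrite -(subrKA (\sum_(z <- Z) u z)) (le_lt_trans (ler_normcD _ _))//.
rewrite [ltRHS]splitr ler_ltD ?uX// normcBC.
apply: le_trans uZ; rewrite -(sum_over_fibres _ ZY) -sumrB.
exact: ler_normc_sum.
Qed.

End Fibres.

(** * Convolution over the factorizations of an element *)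

(** The relation [adm] makes the abstraction cover both Dirichlet convolution,
    where every pair is admissible, and unitary convolution, where the two factors
    have to be coprime, in one variable and in several. *)
Section Convolution.
Variables (A : comNzRingType) (X : choiceType).
Variables (op : X -> X -> X) (adm : rel X) (one : X) (fac : X -> {fset X * X}).
Hypothesis facE : forall N x,
  (x \in fac N) = adm x.1 x.2 && (op x.1 x.2 == N).
Hypothesis opA : associative op.
Hypothesis admA : forall a b c,
  adm a b && adm (op a b) c = adm b c && adm a (op b c).
Hypothesis op1 : left_id one op.
Hypothesis adm1 : forall a, adm one a.
Implicit Types u v w : X -> A.

Definition conv u v N := \sum_(x <- fac N) u x.1 * v x.2.

(** Both sides run over the admissible factorizations of [N] into three
    factors. *)
Lemma convA u v w N : conv u (conv v w) N = conv (conv u v) w N.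
Proof.
pose F (t : (X * (X * X))%type) := u t.1 * (v t.2.1 * w t.2.2).
transitivity (\sum_(t <- [seq (x.1, y) | x <- enum_fset (fac N), y <- enum_fset (fac x.2)]) F t).
  by rewrite big_allpairs_dep; apply: eq_bigr => x _; rewrite /conv mulr_sumr.
transitivity
    (\sum_(t <- [seq (y.1, (y.2, x.2)) | x <- enum_fset (fac N), y <- enum_fset (fac x.1)]) F t); last first.
  rewrite big_allpairs_dep; apply: eq_bigr => x _.
  by rewrite /conv mulr_suml; apply: eq_bigr => y _; rewrite /F mulrA.
have opE c (x : (X * X)%type) : x \in fac c -> op x.1 x.2 = c.
  by rewrite facE => /andP[_ /eqP].
apply: perm_big; apply: uniq_perm => [||[a [b c]]].
- apply: allpairs_uniq_dep => [|? _|[[a b] y] [[a' b'] y']]; rewrite ?fset_uniq//.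
  move=> /allpairsPdep[x [z [_ + /eqP]]]; rewrite -tag_eqE /tag_eq/=.
  case: eqP => // <-; rewrite tagged_asE => /opE/= zb /eqP yz.
  move=> /allpairsPdep[x' [z' [_ + /eqP]]]; rewrite -tag_eqE /tag_eq/=.
  case: eqP => // <-; rewrite tagged_asE => /opE/= zb' /eqP yz' [-> yy'].
  have bb' : b = b' by rewrite -zb -zb' -yz -yz' yy'.
  by rewrite -yy' -bb'.
- apply: allpairs_uniq_dep => [|? _|[[a b] y] [[a' b'] y']]; rewrite ?fset_uniq//.
  move=> /allpairsPdep[x [z [_ + /eqP]]]; rewrite -tag_eqE /tag_eq/=.
  case: eqP => // <-; rewrite tagged_asE => /opE/= zb /eqP yz.
  move=> /allpairsPdep[x' [z' [_ + /eqP]]]; rewrite -tag_eqE /tag_eq/=.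
  case: eqP => // <-; rewrite tagged_asE => /opE/= zb' /eqP yz' [yy1 yy2 ->].
  have yy' : y = y' by case: (y) (y') yy1 yy2 => ? ? [? ?] /= -> ->.
  have aa' : a = a' by rewrite -zb -zb' -yz -yz' yy'.
  by rewrite -yy' -aa'.
- apply/allpairsPdep/allpairsPdep => -[[p q] [[y z] [+ + [-> -> ->]]]].
  + rewrite !facE /= => /andP[adx /eqP opx] /andP[ady /eqP opy].
    have /andP[ad1 ad2] : adm p y && adm (op p y) z by rewrite admA opy ady.
    exists (op p y, z), (p, y).
    by rewrite !facE /= ad1 ad2 eqxx -opA opy opx eqxx.
  + rewrite !facE /= => /andP[adx /eqP opx] /andP[ady /eqP opy].
    have /andP[ad1 ad2] : adm z q && adm y (op z q) by rewrite -admA opy ady.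
    exists (y, op z q), (z, q).
    by rewrite !facE /= ad1 ad2 eqxx opA opy opx eqxx.
Qed.

Lemma conv1 u N : conv (fun a => (a == one)%:R) u N = u N.
Proof.
have oneN : (one, N) \in fac N by rewrite facE /= adm1 op1 eqxx.
rewrite /conv (big_fsetD1 _ oneN)/= eqxx mul1r big1_seq ?addr0// => -[a b].
rewrite !inE xpair_eqE facE /= => /and3P[ab _ /eqP abN].
case: eqVneq ab abN => [-> /= bN|]; last by rewrite mul0r.
by rewrite op1 => bN'; rewrite bN' eqxx in bN.
Qed.

(** Moebius inversion, by associativity: the hypothesis says that [m] is a
    convolution inverse of the constant 1. *)
Lemma conv_inversion m v N :
  (forall a, \sum_(x <- fac a) m x.2 = (a == one)%:R) ->
  \sum_(x <- fac N) conv m v x.2 = v N.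
Proof.
move=> m1; rewrite -(conv1 v N) -[RHS](_ : conv (conv (fun=> 1) m) v N = _).
  by rewrite -convA; apply: eq_bigr => x _; rewrite mul1r.
by apply: eq_bigr => x _; congr (_ * _); rewrite -m1; apply: eq_bigr => y _;
  rewrite mul1r.
Qed.

End Convolution.

Section ProductOfFiniteSets.
Variables (T : choiceType) (k : nat) (A : 'I_k -> {fset T}).

Definition ffprod : {fset {ffun 'I_k -> T}} :=
  let X := (\bigcup_(i <- enum 'I_k) A i)%fset in
  [fset [ffun i => val (h i)] | h : {ffun 'I_k -> X} in
    family (fun i => [pred x : X | val x \in A i])]%fset.

Lemma ffprodP (h : {ffun 'I_k -> T}) :
  reflect (forall i, h i \in A i) (h \in ffprod).
Proof.
apply: (iffP (imfsetP _ _ _ _)) => /= [[g /familyP gA ->] i|hA].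
  by rewrite ffunE; have := gA i; rewrite inE.
have hX i : h i \in (\bigcup_(i <- enum 'I_k) A i)%fset.
  by apply/bigfcupP; exists i; rewrite ?mem_enum.
exists [ffun i => FSetSub (hX i)].
  by apply/familyP => i; rewrite ffunE inE hA.
by apply/ffunP => i; rewrite !ffunE.
Qed.

(** Distributivity of the product over the sums.  The choices [h] become finite
    functions once their values are seen in the union of the [A i], a finite type. *)
Lemma prod_sum_ffprod (C : comNzRingType) (phi : 'I_k -> T -> C) :
  \prod_(i < k) \sum_(x <- A i) phi i x
    = \sum_(h <- ffprod) \prod_(i < k) phi i (h i).
Proof.
rewrite /ffprod; set X := (\bigcup_(i <- enum 'I_k) A i)%fset.
rewrite big_imfset/=; last first.
  move=> g g' _ _ /ffunP gg'; apply/ffunP => i; apply: val_inj.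
  by have := gg' i; rewrite !ffunE.
transitivity (\prod_(i < k) \sum_(x : X | val x \in A i) phi i (val x)).
  apply: eq_bigr => i _; rewrite -(big_seq_fsetE _ X (mem (A i)) (phi i))/=.
  rewrite -[RHS]big_filter; apply: perm_big; apply: uniq_perm => [||x].
  - exact: fset_uniq.
  - by rewrite filter_uniq.
  rewrite mem_filter; case: (boolP (x \in A i)) => //= xA; apply/esym.
  by apply/bigfcupP; exists i; rewrite ?mem_enum.
rewrite (bigA_distr_big_dep (fun i => [pred x : X | val x \in A i])
  (fun i x => phi i (val x))).
rewrite [RHS]big_enum/=.
by apply: eq_bigr => g _; apply: eq_bigr => i _; rewrite ffunE.
Qed.

End ProductOfFiniteSets.
(** * Factorizations of monic polynomials *)

Section Monic.
Variable F : finFieldType.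
Implicit Types (U V W N H P Q R : Aplus F) (D : {poly F}).

Lemma Aplus_neq0 U : (U : {poly F}) != 0.
Proof. exact/monic_neq0/Aplus_monic. Qed.

Lemma Aplus_eqp U V : (U : {poly F}) %= V -> U = V.
Proof. by rewrite eqp_monic ?Aplus_monic// => /eqP/val_inj. Qed.

Lemma Aplus_mulA : associative (@Aplus_mul F).
Proof. by move=> U V W; apply: val_inj; rewrite /= mulrA. Qed.

Lemma Aplus_mulC : commutative (@Aplus_mul F).
Proof. by move=> U V; apply: val_inj; rewrite /= mulrC. Qed.

Lemma Aplus_mul1 : left_id (Aplus1 F) (@Aplus_mul F).
Proof. by move=> U; apply: val_inj; rewrite /= mul1r. Qed.

Lemma Aplus_mulI U V W : Aplus_mul U W = Aplus_mul V W -> U = V.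
Proof.
by move=> /(congr1 val)/= /(mulIf (Aplus_neq0 W))/val_inj.
Qed.

Lemma dvdpP_Aplus U N :
  reflect (exists V, Aplus_mul V U = N) ((U : {poly F}) %| N).
Proof.
apply: (iffP idP) => [UN|[V <-]]; last by rewrite dvdp_mull.
by exists (Aplus_div N U); rewrite Aplus_mulKdiv.
Qed.

Lemma Aplus_div_mul U V : Aplus_div (Aplus_mul U V) V = U.
Proof. by apply: (@Aplus_mulI _ _ V); rewrite Aplus_mulKdiv//= dvdp_mull. Qed.

Lemma dvdp_Aplus1 U : (U : {poly F}) %| 1 -> U = Aplus1 F.
Proof. by move=> U1; apply: Aplus_eqp; rewrite /eqp U1 dvd1p. Qed.

(** A nontrivial monic divisor of least degree is irreducible. *)
Lemma irreducible_divisor D : D != 0 -> size D != 1%N ->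
  exists2 P : Aplus F, irreducible_poly P & (P : {poly F}) %| D.
Proof.
move=> D0 D1.
pose good n := `[< exists U, [/\ size U = n, (U : {poly F}) %| D & (1 < n)%N] >].
have monicE (E : {poly F}) : E != 0 ->
    exists U, ((U : {poly F}) %= E) /\ size U = size E.
  move=> E0; have lc0 : (lead_coef E)^-1 != 0 by rewrite invr_eq0 lead_coef_eq0.
  have EM : (lead_coef E)^-1 *: E \is monic.
    by rewrite monicE lead_coefZ mulVf// lead_coef_eq0.
  exists (MkAplus EM) => /=; rewrite size_scale//; split=> //.
  by rewrite eqp_scale.
have big (E : {poly F}) : E != 0 -> size E != 1%N -> (1 < size E)%N.
  by move=> E0 E1; rewrite ltn_neqAle eq_sym E1 lt0n size_poly_eq0.
have : exists n, good n.
  have [U [UD sU]] := monicE D D0; exists (size D); apply/asboolP; exists U.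
  by rewrite (eqp_dvdl _ UD) dvdpp big.
case/ex_minnP => n /asboolP[P [sP PD n1]] nmin.
exists P => //; split=> [|E E1 EP]; first by rewrite sP.
have E0 : E != 0 by apply: dvdpN0 EP (Aplus_neq0 P).
rewrite -dvdp_size_eqp// eqn_leq dvdp_leq ?Aplus_neq0//= sP; apply: nmin.
have [U [UE sU]] := monicE E E0; apply/asboolP; exists U.
by rewrite (eqp_dvdl _ UE) (dvdp_trans EP PD) big.
Qed.

Lemma irreducible_dvdM P D E : irreducible_poly P ->
  (P : {poly F}) %| D * E -> (P : {poly F}) %| D \/ (P : {poly F}) %| E.
Proof.
move=> Pirr; have [|PD] := boolP ((P : {poly F}) %| D); first by left.
by rewrite Gauss_dvdpr ?irreducible_poly_coprime//; right.
Qed.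

Lemma irreducible_dvd_irreducible P Q : irreducible_poly P ->
  irreducible_poly Q -> (P : {poly F}) %| Q -> P = Q.
Proof.
by move=> [P1 _] [_ Qirr] PQ; apply/Aplus_eqp/Qirr; rewrite // gtn_eqF.
Qed.

Lemma irreducible_not_dvd1 P D : irreducible_poly P -> (P : {poly F}) %| D ->
  ~~ (D %= 1).
Proof.
move=> [P1 _] PD; apply/negP => D1; move: PD.
by rewrite (eqp_dvdr _ D1) dvdp1 gtn_eqF.
Qed.

Lemma common_irreducible_divisor U V : ~~ coprimep U V ->
  exists2 P : Aplus F, irreducible_poly P &
    ((P : {poly F}) %| U) && ((P : {poly F}) %| V).
Proof.
rewrite coprimep_def => UV.
have [|P Pirr] := irreducible_divisor _ UV.
  by rewrite gcdp_eq0 negb_and Aplus_neq0.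
by rewrite dvdp_gcd; exists P.
Qed.

Definition prime_set U : {fset Aplus F} :=
  fset_set [set P : Aplus F | irreducible_poly P /\ (P : {poly F}) %| U].

Lemma prime_setP U P :
  reflect (irreducible_poly P /\ (P : {poly F}) %| U) (P \in prime_set U).
Proof. by apply: (iffP idP) => /omegaE. Qed.

Lemma prime_setS U V : (U : {poly F}) %| V ->
  (prime_set U `<=` prime_set V)%fset.
Proof.
move=> UV; apply/fsubsetP => P /prime_setP[Pirr PU]; apply/prime_setP.
by split=> //; apply: dvdp_trans PU UV.
Qed.

Lemma omegaS U V : (U : {poly F}) %| V -> (omega U <= omega V)%N.
Proof. by move=> /prime_setS/fsubset_leq_card. Qed.

Lemma omega1 : omega (Aplus1 F) = 0%N.
Proof.
apply/eqP; rewrite cardfs_eq0; apply/eqP/fsetP => P; rewrite inE.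
by apply/negP => /prime_setP[/irreducible_not_dvd1 Pirr /Pirr]; rewrite eqpxx.
Qed.

Definition adm (star : bool) U V : bool := star ==> coprimep U V.

Lemma adm_assoc star U V W :
  adm star U V && adm star (Aplus_mul U V) W
    = adm star V W && adm star U (Aplus_mul V W).
Proof.
rewrite /adm; case: star => //=; rewrite coprimepMl coprimepMr.
by case: coprimep; case: coprimep; case: coprimep.
Qed.

Lemma adm1 star U : adm star (Aplus1 F) U.
Proof. by rewrite /adm coprime1p implybT. Qed.

Lemma admC star U V : adm star U V = adm star V U.
Proof. by rewrite /adm coprimep_sym. Qed.

(** For [star = true] the first components are the unitary divisors of [N], for
    [star = false] all its divisors; the choice of [star] selects between the two
    halves of the theory throughout. *)
Definition fac (star : bool) N : {fset Aplus F * Aplus F} :=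
  fset_set [set x | adm star x.1 x.2 && (Aplus_mul x.1 x.2 == N)].

Lemma facE star N x :
  (x \in fac star N) = adm star x.1 x.2 && (Aplus_mul x.1 x.2 == N).
Proof.
rewrite in_fset_set; first by apply/idP/idP; rewrite inE.
have := finite_image (fun V => (Aplus_div N V, V)) (finite_divisors N).
apply: sub_finite_set => -[U V] /= /andP[_ /eqP <-]; exists V.
  by rewrite /= dvdp_mull.
by rewrite Aplus_div_mul.
Qed.

Lemma fac_snd_inj star N : {in fac star N &, injective (fun x => x.2)}.
Proof.
move=> [U V] [U' V']; rewrite !facE /= => /andP[_ /eqP UV].
move=> /andP[_ /eqP UV'] VV'; congr pair => //.
by apply: (@Aplus_mulI _ _ V); rewrite UV {1}VV' UV'.
Qed.

Lemma fac_fst_inj star N : {in fac star N &, injective (fun x => x.1)}.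
Proof.
move=> [U V] [U' V']; rewrite !facE /= => /andP[_ /eqP UV].
move=> /andP[_ /eqP UV'] UU'; congr pair => //.
by apply: (@Aplus_mulI _ _ U); rewrite Aplus_mulC UV {1}UU' Aplus_mulC UV'.
Qed.

(** Admissibility is symmetric, so the two factors can be exchanged. *)
Lemma fac_swap (T : nmodType) star N (phi : Aplus F -> Aplus F -> T) :
  \sum_(x <- fac star N) phi x.1 x.2 = \sum_(x <- fac star N) phi x.2 x.1.
Proof.
rewrite -(big_map (fun x : Aplus F * Aplus F => (x.2, x.1)) predT
  (fun x => phi x.1 x.2)).
apply: perm_big; apply: uniq_perm => [||[U V]]; rewrite ?fset_uniq//.
  by rewrite map_inj_uniq ?fset_uniq// => -[? ?] [? ?] [-> ->].
rewrite facE /= admC Aplus_mulC; apply/idP/mapP => [UV|[[V' U']]].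
  by exists (V, U) => //; rewrite facE.
by rewrite facE /= => + [-> ->].
Qed.

(** * Sums of Moebius functions *)

(** The divisors of [H] at which the Moebius function of Dirichlet or unitary
    convolution does not vanish: the square-free or the unitary ones. *)
Definition basic star H U : bool :=
  ((U : {poly F}) %| H) &&
  (if star then coprimep U (H %/ U) else `[< squarefree U >]).

(** For [star = false] this is the classical Moebius function, for [star = true]
    its unitary analogue, which vanishes nowhere. *)
Definition moebius star U : int :=
  if star || `[< squarefree U >] then (-1) ^+ omega U else 0.

Definition basic_divisors star H D : {fset Aplus F} :=
  fset_set [set U | basic star H U && ((U : {poly F}) %| D)].

Lemma basic_divisorsE star H D U :
  (U \in basic_divisors star H D) = basic star H U && ((U : {poly F}) %| D).
Proof.
rewrite in_fset_set; first by apply/idP/idP; rewrite inE.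
by apply: sub_finite_set (finite_divisors H) => V /andP[/andP[]].
Qed.

Lemma sum_fac_basic (T : nmodType) star H D (phi : Aplus F -> T) :
  \sum_(x <- fac star H | ((x.1 : {poly F}) %| D) &&
                           (star || `[< squarefree x.1 >])) phi x.1
    = \sum_(U <- basic_divisors star H D) phi U.
Proof.
rewrite -big_filter -(big_map (fun x : Aplus F * Aplus F => x.1) predT phi).
apply: perm_big; apply: uniq_perm => [||U]; rewrite ?fset_uniq//.
  rewrite map_inj_in_uniq ?filter_uniq ?fset_uniq// => x y.
  rewrite !mem_filter => /andP[_ xH] /andP[_ yH]; exact: fac_fst_inj xH yH.
rewrite basic_divisorsE /basic; apply/mapP/idP => [[[U' V]]|].
  rewrite mem_filter facE /= => /andP[/andP[UD sq] /andP[UV /eqP <-]] ->.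
  rewrite /= dvdp_mulr// mulrC mulpK ?Aplus_neq0// UD andbT.
  by case: (star) UV sq.
move=> /andP[/andP[/dvdpP_Aplus[V <-] + UD]] => sq.
exists (U, V) => //; rewrite mem_filter facE /= UD Aplus_mulC eqxx andbT.
by move: sq; rewrite /= mulpK ?Aplus_neq0// /adm; case: (star) => //= ->.
Qed.

Lemma irreducible_multiplicity P H : irreducible_poly P ->
  exists a, exists2 K : {poly F}, (H : {poly F}) = K * (P : {poly F}) ^+ a &
    ~~ ((P : {poly F}) %| K).
Proof.
move=> [P1 _]; have P0 : exists a, (P : {poly F}) ^+ a %| H.
  by exists 0%N; rewrite expr0 dvd1p.
have Pmax a : (P : {poly F}) ^+ a %| H -> (a <= size H)%N.
  move=> /(dvdp_leq (Aplus_neq0 H)); apply: leq_trans.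
  apply: leq_trans (leq_pred _); rewrite size_exp leq_pmull//.
  by rewrite -ltnS prednK// ltnW.
case: (ex_maxnP P0 Pmax) => a /dvdpP[K HK] amax; exists a; exists K => //.
apply/negP => PK; suff : (a.+1 <= a)%N by rewrite ltnn.
by apply: amax; rewrite HK exprS dvdp_mul.
Qed.

Lemma irreducible_dvd_exp P Q a : irreducible_poly P -> irreducible_poly Q ->
  (Q : {poly F}) %| (P : {poly F}) ^+ a -> Q = P.
Proof.
move=> Pirr Qirr QPa; apply: (irreducible_dvd_irreducible Qirr Pirr).
apply/negPn/negP => QP; move: QPa; rewrite -[X in _ %| X]mulr1 Gauss_dvdpr.
  by move=> /(irreducible_not_dvd1 Qirr); rewrite eqpxx.
by apply: coprimep_expr; rewrite irreducible_poly_coprime.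
Qed.

(** The involution behind the cancellation of Moebius values.  A basic divisor of
    [H] involves the prime [P] in only one way: through [P] itself if it is
    square-free, through the exact power of [P] in [H] if it is unitary.  That
    primary part [Q] can therefore be inserted into a basic divisor prime to [P],
    and removed from any other.  It divides [D] because it divides [U]. *)
Lemma basic_toggle star H D U V P : (U, V) \in fac star H ->
  (U : {poly F}) %| D -> irreducible_poly P -> (P : {poly F}) %| U ->
  exists Q, [/\ (Q : {poly F}) %| D,
    forall R, irreducible_poly R -> ((R : {poly F}) %| Q) = (R == P),
    forall W, ~~ ((P : {poly F}) %| W) ->
      basic star H (Aplus_mul W Q) = basic star H W &
    forall W, basic star H W -> (P : {poly F}) %| W ->
      exists2 W' : Aplus F, ~~ ((P : {poly F}) %| W') & W = Aplus_mul W' Q].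
Proof.
rewrite facE /= => /andP[UV /eqP UVH] UD Pirr PU.
case: star UV => /= [UV|_]; last first.
  exists P; split=> [|R Rirr|W PW|W /andP[_ /asboolP Wsq] /dvdpP_Aplus[W' W'P]].
  - exact: dvdp_trans PU UD.
  - apply/idP/eqP => [|->]; last exact: dvdpp.
    exact: irreducible_dvd_irreducible.
  - have WP : coprimep W P by rewrite coprimep_sym irreducible_poly_coprime.
    have PH : (P : {poly F}) %| H by rewrite -UVH /= dvdp_mulr.
    rewrite /basic /= Gauss_dvdp// PH andbT; congr (_ && _).
    apply/asboolP/asboolP => Wsq E EW; first by apply: Wsq; rewrite dvdp_mulr.
    have [PE|PE] := boolP ((P : {poly F}) %| E).
      case/negP: PW; have : (P : {poly F}) ^+ 2 %| (W : {poly F}) * P.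
        exact: dvdp_trans (dvdp_exp2r 2 PE) EW.
      by rewrite expr2 dvdp_mul2r// Aplus_neq0.
    apply: Wsq; rewrite -(Gauss_dvdpl _ (_ : coprimep (E ^+ 2) P))//.
    by rewrite coprimep_pexpl// coprimep_sym irreducible_poly_coprime.
  - exists W' => //; apply/negP => PW'.
    have := Wsq P; rewrite -W'P expr2 /= dvdp_mul// => /(_ isT).
    by case: Pirr => + _; rewrite ltnNge => /negP.
have [a [K HK PK]] := irreducible_multiplicity H Pirr.
have a0 : (0 < a)%N.
  rewrite lt0n; apply: contraNneq PK => a0.
  by rewrite -[K]mulr1 -(expr0 (P : {poly F})) -a0 -HK -UVH /= dvdp_mulr.
have Qmon : (P : {poly F}) ^+ a \is monic by rewrite monic_exp ?Aplus_monic.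
pose Q := MkAplus Qmon.
have Q0 : (Q : {poly F}) != 0 := Aplus_neq0 Q.
(* [P] divides only one of two coprime factors of [H], which thus carries the
   whole power. *)
have Q_unitary W W' : coprimep W W' -> (W : {poly F}) * W' = H ->
    (P : {poly F}) %| W -> (Q : {poly F}) %| W.
  move=> WW' WH PW; rewrite -(Gauss_dvdpl W (_ : coprimep Q W')).
    by rewrite WH HK dvdp_mull.
  by rewrite /= coprimep_pexpl// (coprimep_dvdr _ WW').
have Q_coprime E : coprimep E ((P : {poly F}) ^+ a) = ~~ ((P : {poly F}) %| E).
  by rewrite coprimep_pexpr// coprimep_sym irreducible_poly_coprime.
exists Q; split=> [|R Rirr|W PW|W /andP[/dvdpP_Aplus[W' WH] +] PW].
- apply: dvdp_trans UD; apply: (Q_unitary _ V) => //.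
  by rewrite -UVH.
- apply/idP/eqP => [|->]; first exact: irreducible_dvd_exp.
  by rewrite /= dvdp_exp.
- rewrite /basic /= HK dvdp_mul2r// [X in _ = X && _]Gauss_dvdpl ?Q_coprime//.
  have [/dvdpP[E KE]|//] := boolP ((W : {poly F}) %| K).
  have PE : ~~ ((P : {poly F}) %| E).
    by apply: contra PK => PE; rewrite KE dvdp_mulr.
  rewrite /= {}KE -(mulrA E) mulpK ?mulf_neq0 ?Aplus_neq0//.
  rewrite mulrCA mulKp ?Aplus_neq0// coprimepMl coprimepMr.
  by rewrite Q_coprime PW andbT [X in _ && X]coprimep_sym Q_coprime PE andbT.
- rewrite -WH /= mulpK ?Aplus_neq0// => WW'.
  have /dvdpP_Aplus[E WE] : (Q : {poly F}) %| W.
    by apply: (Q_unitary _ W') => //; rewrite -WH /= mulrC.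
  exists E => //; apply: contra PK => PE.
  rewrite (_ : K = (W' : {poly F}) * E) ?dvdp_mull//.
  by apply: (mulIf Q0); rewrite -HK -WH -WE /= mulrA.
Qed.

Lemma omega_toggle P Q W : irreducible_poly P ->
  (forall R, irreducible_poly R -> ((R : {poly F}) %| Q) = (R == P)) ->
  ~~ ((P : {poly F}) %| W) -> omega (Aplus_mul W Q) = (omega W).+1.
Proof.
move=> Pirr QP PW; rewrite /omega -/(prime_set W) -/(prime_set (Aplus_mul W Q)).
have PnW : P \notin prime_set W by apply: contra PW => /prime_setP[].
rewrite (_ : prime_set (Aplus_mul W Q) = P |` prime_set W)%fset.
  by rewrite cardfsU1 PnW.
apply/fsetP => R; rewrite in_fset1U; apply/prime_setP/orP.
  move=> [Rirr /(irreducible_dvdM Rirr)[RW|]].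
    by right; apply/prime_setP.
  by rewrite QP//; left.
case=> [/eqP ->|/prime_setP[Rirr RW]].
  by split=> //; rewrite dvdp_mull// QP.
by split=> //; rewrite dvdp_mulr.
Qed.

(** Inserting or removing the primary part [Q] of a prime factor of [U] pairs off
    the basic divisors of [H] that divide [D] and reverses the sign. *)
Lemma sum_basic_eq0 star H D U V : (U, V) \in fac star H ->
  (U : {poly F}) %| D -> U != Aplus1 F ->
  \sum_(W <- basic_divisors star H D) (-1) ^+ omega W = 0 :> int.
Proof.
move=> UVH UD U1.
have [|P Pirr PU] := irreducible_divisor (Aplus_neq0 U).
  by apply: contraNneq U1 => /eqP; rewrite -dvdp1 => /dvdp_Aplus1 ->.
have [Q [QD QP Qbasic Qsplit]] := basic_toggle UVH UD Pirr PU.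
rewrite (bigID (fun W : Aplus F => (P : {poly F}) %| W))/=; apply/eqP.
rewrite addrC addr_eq0 -sumrN; apply/eqP/esym.
pose s := [seq W : Aplus F <- basic_divisors star H D |
  ~~ ((P : {poly F}) %| W)].
transitivity
    (\sum_(W <- [seq Aplus_mul W Q | W <- s]) - (-1) ^+ omega W : int).
  rewrite -[LHS]big_filter; apply: perm_big; apply: uniq_perm => [||W].
  - by rewrite filter_uniq ?fset_uniq.
  - rewrite map_inj_uniq ?filter_uniq//; first exact: fset_uniq.
    by move=> ? ?; apply: Aplus_mulI.
  rewrite mem_filter basic_divisorsE; apply/idP/mapP => [|[W' + ->]].
    move=> /and3P[PW Wb WD]; have [W' PW' WW'] := Qsplit W Wb PW.
    exists W' => //; rewrite mem_filter PW' basic_divisorsE.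
    rewrite -Qbasic// -WW' Wb; apply: dvdp_trans WD.
    by rewrite WW' /= dvdp_mulr.
  rewrite mem_filter basic_divisorsE => /and3P[PW' W'b W'D].
  rewrite Qbasic// W'b /= Gauss_dvdp ?W'D ?QD ?andbT.
    by rewrite dvdp_mull// QP.
  apply/negPn/negP => /common_irreducible_divisor[R Rirr /andP[RW']].
  by rewrite QP// => /eqP RP; rewrite -RP RW' in PW'.
rewrite big_map big_filter; apply: eq_bigr => W PW.
by rewrite (omega_toggle Pirr QP PW) exprS mulN1r opprK.
Qed.

Lemma basic1 star H : basic star H (Aplus1 F).
Proof.
rewrite /basic dvd1p coprime1p; case: star => //=.
apply/asboolP => E; rewrite expr2 => E1.
rewrite (leq_trans (dvdp_leq (oner_neq0 _) (_ : E %| 1))) ?size_poly1//.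
by apply: dvdp_trans E1; rewrite dvdp_mulr.
Qed.

(** This detects the residues [D] over which a Ramanujan sum extends; for [D = H]
    it is the inversion property of the Moebius function. *)
Lemma sum_moebius star H D :
  \sum_(x <- fac star H | (x.1 : {poly F}) %| D) moebius star x.1
    = `[< forall x, x \in fac star H -> (x.1 : {poly F}) %| D ->
            x.1 = Aplus1 F >]%:R.
Proof.
transitivity (\sum_(W <- basic_divisors star H D) (-1) ^+ omega W : int).
  by rewrite -sum_fac_basic big_mkcondr.
case: asboolP => [triv|/existsNP[[U V] /not_implyP[UV /not_implyP[UD /eqP U1]]]].
  rewrite (_ : basic_divisors star H D = [fset Aplus1 F]%fset).
    by rewrite big_seq_fset1 omega1.
  apply/fsetP => U; rewrite inE basic_divisorsE; apply/idP/eqP => [|->].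
    move=> /andP[/andP[/dvdpP_Aplus[V VU] sq] UD].
    apply: (triv (U, V)) => //; rewrite facE /= Aplus_mulC VU eqxx andbT /adm.
    move: sq; case: (star) => //=.
    by rewrite -VU /= mulpK ?Aplus_neq0.
  by rewrite basic1 dvd1p.
exact: sum_basic_eq0 UV UD U1.
Qed.

(** Applied in both directions, it shows that a basic divisor of [H] is
    determined by its prime factors: a unitary one has the exact powers in [H],
    a square-free one the first powers. *)
Lemma basic_dvdp star H U V : basic star H U -> basic star H V ->
  (prime_set U `<=` prime_set V)%fset -> (U : {poly F}) %| V.
Proof.
move=> /andP[UH Usq] /andP[/dvdpP_Aplus[W VH] Vsq] /fsubsetP UV.
case: star Usq Vsq => [_|/asboolP Usq _].
  rewrite -VH /= mulpK ?Aplus_neq0// => VW.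
  rewrite -(Gauss_dvdpr _ (_ : coprimep U W)); first by rewrite -VH in UH.
  apply/negPn/negP => /common_irreducible_divisor[P Pirr /andP[PU PW]].
  have /prime_setP[_ PV] : P \in prime_set V by apply/UV/prime_setP.
  have /coprimepP/(_ P PV PW) := VW.
  exact/negP/(irreducible_not_dvd1 Pirr (dvdpp P)).
have g0 : gcdp U V != 0 by rewrite gcdp_eq0 negb_and Aplus_neq0.
have /dvdpP[E UE] := dvdp_gcdl U V.
have E0 : E != 0 by apply: contraNneq (Aplus_neq0 U) => E0; rewrite UE E0 mul0r.
suff /eqP E1 : size E == 1%N.
  suff Ug : (U : {poly F}) %= gcdp U V by rewrite (eqp_dvdl _ Ug) dvdp_gcdr.
  rewrite [X in X %= _]UE -[X in _ %= X]mul1r eqp_mulr//.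
  by rewrite -size_poly_eq1 E1.
apply/negPn/negP => sE; have [P Pirr PE] := irreducible_divisor E0 sE.
have PU : (P : {poly F}) %| U by rewrite UE dvdp_mulr.
have /prime_setP[_ PV] : P \in prime_set V by apply/UV/prime_setP.
have := Usq P; rewrite UE expr2 dvdp_mul ?dvdp_gcd ?PU// => /(_ isT).
by case: Pirr => + _; rewrite ltnNge => /negP.
Qed.

Lemma card_basic_divisors star H D :
  (#|` basic_divisors star H D| <= 2 ^ omega H)%N.
Proof.
rewrite -[omega H]/#|` prime_set H| -card_fpowerset.
apply: leq_trans (_ : #|` [fset prime_set U | U in basic_divisors star H D]%fset|
  <= _)%N.
  rewrite card_in_imfset//= => U V; rewrite !basic_divisorsE.
  move=> /andP[Ub _] /andP[Vb _] UV; apply: Aplus_eqp.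
  by rewrite /eqp !(basic_dvdp Ub Vb, basic_dvdp Vb Ub) ?UV.
apply/fsubset_leq_card/fsubsetP => _ /imfsetP[U /= + ->].
by rewrite basic_divisorsE fpowersetE => /andP[/andP[/prime_setS]].
Qed.

(** There are at most as many basic divisors of [H] as sets of primes dividing
    [H].  This is the origin of the factor [2 ^ omega] in the summability
    hypothesis. *)
Lemma sum_abs_moebius star H :
  (\sum_(x <- fac star H) `|moebius star x.1| <= 2 ^+ omega H)%R.
Proof.
(* Every divisor of [H] divides 0. *)
pose D := (0 : {poly F}).
apply: le_trans (_ : (#|` basic_divisors star H D|)%:R <= _); last first.
  by rewrite -natrX ler_nat card_basic_divisors.
rewrite card_fset_sum1 natr_sum -sum_fac_basic le_eqVlt; apply/orP; left.
apply/eqP; rewrite [RHS]big_mkcond; apply: eq_bigr => x _.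
by rewrite dvdp0 /moebius; case: ifP => _; rewrite ?normr0// normrX normrN1 expr1n.
Qed.

End Monic.
(** * Additive characters modulo a polynomial *)

(** By the linear independence of automorphisms. *)
Lemma galTrace_neq0 (K : fieldType) (L : splittingFieldType K) :
  exists x, galTrace 1%VS {:L} x != 0.
Proof.
have [|a _ a0] := @gal_independent_contra _ L {:L}%AS
  [in 'Gal({:L} / 1%VS)%g] (fun=> 1) 1%g (fingroup.group1 _).
  exact: oner_neq0.
by exists a; move: a0; under eq_bigr do rewrite mul1r.
Qed.

Section Trace.
Variables (F : finFieldType) (p : nat) (charFp : p \in [pchar F]).
Let L := pPrimeCharType charFp.

Lemma FpTraceD (x y : F) :
  FpTrace charFp (x + y) = FpTrace charFp x + FpTrace charFp y.
Proof.
apply: (fmorph_inj (in_alg L)); rewrite rmorphD /= !FpTraceP.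
exact: (raddfD (galTrace 1%VS {:L})).
Qed.

Lemma FpTrace_neq0 : exists x : F, FpTrace charFp x != 0.
Proof.
have [x x0] := galTrace_neq0 L; exists x.
by apply: contraNneq x0 => tr0; rewrite -FpTraceP tr0 scale0r.
Qed.

End Trace.

Section RootsOfUnity.
Variables (R : realType) (p : nat).
Hypothesis p_gt0 : (0 < p)%N.

Definition unity_exp (n : nat) : R[i] :=
  let theta := 2 * pi * n%:R / p%:R in cos theta +i* sin theta.

Lemma unity_exp0 : unity_exp 0 = 1.
Proof. by rewrite /unity_exp mulr0 mul0r cos0 sin0. Qed.

Lemma unity_expD m n : unity_exp (m + n) = unity_exp m * unity_exp n.
Proof.
rewrite /unity_exp natrD mulrDr mulrDl cosD sinD.
by apply/eqP; rewrite eq_complex /= eqxx /= addrC [X in _ + X]mulrC.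
Qed.

Lemma unity_exp_mod n : unity_exp (n %% p) = unity_exp n.
Proof.
have pM q : unity_exp (q * p) = 1.
  elim: q => [|q IHq]; first by rewrite unity_exp0.
  rewrite mulSn unity_expD IHq mulr1 /unity_exp mulfK ?pnatr_eq0 -?lt0n//.
  by rewrite mulr_natl cos2pi sin2pi.
by rewrite {2}(divn_eq n p) unity_expD pM mul1r.
Qed.

Lemma unity_exp_eq1 n : (n < p)%N -> unity_exp n = 1 -> n = 0%N.
Proof.
move=> np [/eqP + _]; case: n np => // n np.
pose x : R := pi * n.+1%:R / p%:R.
rewrite (_ : 2 * pi * _ / _ = x *+ 2); last first.
  by rewrite -[RHS]mulr_natl /x !mulrA.
rewrite cos_mulr2n cos2sin2 mulrnBl addrAC mulr2n addrK subr_eq addrC -subr_eq.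
rewrite subrr eq_sym mulrn_eq0/= expf_eq0/= => /eqP x0.
have := @sin_gt0_pi R x; rewrite x0 ltxx => /(_ _)/negP.
have p0 : 0 < p%:R :> R by rewrite ltr0n.
rewrite /x divr_gt0 ?mulr_gt0 ?pi_gt0 ?ltr0n//= ltr_pdivrMr//.
by rewrite ltr_pM2l ?pi_gt0// ltr_nat np => /(_ isT).
Qed.

End RootsOfUnity.

Section CharacterSums.
Variables (R : realType) (F : finFieldType) (p : nat) (charFp : p \in [pchar F]).
Implicit Types (U V N H : Aplus F) (G A B D : {poly F}).

Let p_prime : prime p := pcharf_prime charFp.
Let p_gt0 : (0 < p)%N := prime_gt0 p_prime.

Lemma add_charE G H A : add_char R charFp G H A
  = unity_exp R p (FpTrace charFp (char_coef H (G * A))).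
Proof. by []. Qed.

Lemma char_coefD H A B : char_coef H (A + B) = char_coef H A + char_coef H B.
Proof. by rewrite /char_coef modpD coefD. Qed.

Lemma add_charD G H A B :
  add_char R charFp G H (A + B) = add_char R charFp G H A * add_char R charFp G H B.
Proof.
rewrite !add_charE mulrDr char_coefD FpTraceD -unity_expD.
rewrite -[RHS](unity_exp_mod R p_gt0) /=.
by congr (unity_exp R p (_ %% _)); apply: Fp_cast.
Qed.

Lemma char_coef_dvdp N G A : (N : {poly F}) %| G -> char_coef N (G * A) = 0.
Proof.
by move=> NG; rewrite /char_coef (eqP (_ : N %| G * A)) ?coef0// dvdp_mulr.
Qed.

Lemma add_char_dvdp N G A : (N : {poly F}) %| G -> add_char R charFp G N A = 1.
Proof.
move=> /char_coef_dvdp NG; rewrite add_charE NG.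
have -> : FpTrace charFp 0 = 0 by apply: (addrI (FpTrace charFp 0)); rewrite -FpTraceD !addr0.
exact: unity_exp0.
Qed.

(** Multiplying the nonzero residue of [G] by a suitable power of ['X] moves its
    leading coefficient to the place read off by the character. *)
Lemma add_char_neq1 N G : ~~ ((N : {poly F}) %| G) ->
  exists2 D : {poly F}, (size D < size N)%N & add_char R charFp G N D != 1.
Proof.
move=> NG; pose r := G %% N.
have r0 : r != 0 by [].
have rN : (size r < size N)%N by rewrite ltn_modp Aplus_neq0.
have [x x0] := FpTrace_neq0 charFp.
pose m := ((size N).-2 - (size r).-1)%N.
have sN : (size N).-2.+2 = size N.
  have : (1 < size N)%N by apply: leq_ltn_trans rN; rewrite lt0n size_poly_eq0.
  by case: (size N) => [|[]].
have sr : (size r).-1.+1 = size r by rewrite prednK// lt0n size_poly_eq0.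
have mN : ((size r).-1 + m)%N = (size N).-2.
  by rewrite /m subnKC// -ltnS sr -ltnS sN.
exists ((x / lead_coef r) *: 'X^m).
  rewrite (leq_ltn_trans (size_scale_leq _ _))// size_polyXn.
  by rewrite -sN ltnS -mN ltnS leq_addl.
rewrite add_charE.
have -> : char_coef N (G * ((x / lead_coef r) *: 'X^m)) = x.
  rewrite /char_coef mulrC -modp_mul -/r modp_small.
    rewrite -scalerAl coefZ mulrC coefXnM -mN ltnNge leq_addl/= addnK.
    by rewrite mulrC divfK// lead_coef_eq0.
  rewrite -scalerAl (leq_ltn_trans (size_scale_leq _ _))// mulrC size_mulXn//.
  by rewrite -sN -mN -{1}sr addnC addSn addnC.
apply: contra x0 => /eqP/unity_exp_eq1 => tr0; apply/eqP/val_inj/tr0 => //.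
by apply: leq_trans (ltn_ord (FpTrace charFp x)) _; rewrite Fp_cast.
Qed.

(** The value of the complete character sum modulo [N], a multiple of the
    indicator function of the divisors of [G]. *)
Definition dvd_norm (T : nzSemiRingType) G N : T :=
  if (N : {poly F}) %| G then (pnorm N)%:R else 0.

(** Orthogonality: translation by a residue at which the character differs from
    1 multiplies the complete sum by that value. *)
Lemma sum_add_char G N :
  \sum_(D : {poly_((size N).-1) F}) add_char R charFp G N D = dvd_norm R[i] G N.
Proof.
rewrite /dvd_norm; case: ifPn => [NG|NG].
  rewrite (eq_bigr (fun=> 1)) => [|D _]; last exact: add_char_dvdp.
  by rewrite sumr_const card_npoly.
have [D0 sD0 D1] := add_char_neq1 NG.
have D0K : npolyp (size N).-1 D0 = D0 :> {poly F}.
  by rewrite npolypK// -ltnS prednK// (leq_ltn_trans _ sD0).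
set S := (X in X = 0).
have SE : S = add_char R charFp G N D0 * S.
  rewrite /S mulr_sumr (reindex_inj (addrI (npolyp (size N).-1 D0))).
  by apply: eq_bigr => D _; rewrite /= D0K add_charD.
apply/eqP; move: SE => /eqP; rewrite -subr_eq0 -{1}[S]mul1r -mulrBl mulf_eq0.
by rewrite subr_eq0 eq_sym (negbTE D1).
Qed.

Lemma size_Aplus_gt0 U : (0 < size U)%N.
Proof. by rewrite lt0n size_poly_eq0 Aplus_neq0. Qed.

(** Multiplication by the monic [U] turns residues modulo [V] into residues modulo
    [UV] and preserves the coefficient read off by the character, which is the one
    in degree one less than that of the modulus. *)
Lemma char_coef_mul U V A :
  char_coef (Aplus_mul U V) ((U : {poly F}) * A) = char_coef V A.
Proof.
rewrite /char_coef /=; set r := A %% V.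
have rV : (size r < size V)%N by rewrite ltn_modp Aplus_neq0.
have sU : (size U).-1.+1 = size U by rewrite prednK// size_Aplus_gt0.
have UV0 : (U : {poly F}) * V != 0 by rewrite mulf_neq0 ?Aplus_neq0.
have -> : ((U : {poly F}) * A) %% ((U : {poly F}) * V) = (U : {poly F}) * r.
  rewrite {1}(divp_eq A V) -/r mulrDr mulrCA modpD modp_mull add0r modp_small//.
  have [->|r0] := eqVneq r 0; first by rewrite mulr0 size_poly0 lt0n size_poly_eq0.
  rewrite !size_mul ?Aplus_neq0//.
  by rewrite -sU !addSn /= ltn_add2l.
rewrite size_mul ?Aplus_neq0// -sU addSn /=.
case sV : (size V) rV => [//|[|n]]; rewrite ltnS /= => rV.
  by move: rV; rewrite leqn0 size_poly_eq0 => /eqP ->; rewrite mulr0 !coef0.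
have Um : ((size U).-1 < ((size U).-1 + n).+1)%N by rewrite ltnS leq_addr.
rewrite !addnS /= coefM (bigD1 (Ordinal Um))//= addKn -lead_coefE.
rewrite (monicP (Aplus_monic U)) mul1r big1 ?addr0// => -[j jn] /=.
rewrite -val_eqE /= neq_ltn => /orP[ju|uj].
  rewrite [X in _ * X]nth_default ?mulr0//; apply: leq_trans rV _.
  by rewrite ltn_subRL ltn_add2r.
by rewrite nth_default ?mul0r// -sU.
Qed.

(** The residues modulo [UV] divisible by [U] are the [UD'] with [D'] a residue
    modulo [V]. *)
Lemma sum_add_char_dvdp G U V :
  \sum_(D : {poly_((size (Aplus_mul U V)).-1) F} | (U : {poly F}) %| D)
     add_char R charFp G (Aplus_mul U V) D = dvd_norm R[i] G V.
Proof.
rewrite -sum_add_char; set n := (size _).-1; set m := (size V).-1.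
have nE : n = ((size U).-1 + m)%N.
  rewrite /n /m /= size_mul ?Aplus_neq0//.
  case: (size U) (size_Aplus_gt0 U) (size V) (size_Aplus_gt0 V) => // a _.
  by case=> // b _; rewrite addSn addnS.
have UD (D : {poly_m F}) : 
    npolyp n ((U : {poly F}) * D) = (U : {poly F}) * D :> {poly F}.
  rewrite npolypK//; apply: leq_trans (size_mul_leq _ _) _.
  rewrite nE; case: (size U) (size_Aplus_gt0 U) => // a _.
  by rewrite addSn /= leq_add2l size_npoly.
rewrite (reindex_onto (fun D : {poly_m F} => npolyp n ((U : {poly F}) * D))
  (fun D : {poly_n F} => npolyp m (D %/ U))) ; last first.
  move=> D UD'; apply: val_inj => /=.
  have DE : npolyp m (D %/ U) = D %/ U :> {poly F}.
    by rewrite npolypK// size_divp ?Aplus_neq0// leq_subLR -nE size_npoly.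
  by rewrite UD DE mulrC divpK.
apply: eq_big => [D|D _]; last first.
  rewrite UD !add_charE. by rewrite mulrCA char_coef_mul.
rewrite UD dvdp_mulr//=; apply/eqP/val_inj => /=.
by rewrite mulKp ?Aplus_neq0// npolypK ?size_npoly.
Qed.

(** * Ramanujan sums *)

Definition ramanujan_sum (star : bool) G H : R[i] :=
  if star then eta_star R charFp G H else eta R charFp G H.

Lemma coprimep_trivial_divisors H D :
  coprimep D H = `[< forall x, x \in fac false H -> (x.1 : {poly F}) %| D ->
                       x.1 = Aplus1 F >].
Proof.
apply/idP/asboolP => [/coprimepP DH [U V]|triv].
  rewrite facE => /andP[_ /eqP UVH] /= UD; apply: Aplus_eqp; apply: DH => //.
  by rewrite -UVH dvdp_mulr.
apply/negPn/negP; rewrite coprimep_def => gcd1.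
have [|P Pirr] := irreducible_divisor _ gcd1.
  by rewrite gcdp_eq0 negb_and Aplus_neq0 orbT.
rewrite dvdp_gcd => /andP[PD /dvdpP_Aplus[V VP]].
have := triv (P, V); rewrite facE /= Aplus_mulC VP eqxx => /(_ isT PD) P1.
by case: Pirr; rewrite P1 /= size_poly1.
Qed.

Lemma ugcd_trivial_divisors H D :
  (ugcd D H == Aplus1 F)
    = `[< forall x, x \in fac true H -> (x.1 : {poly F}) %| D ->
            x.1 = Aplus1 F >].
Proof.
have [UD UH Umax] := ugcdP D H.
apply/eqP/asboolP => [U1 [U V]|triv].
  rewrite facE => /andP[/= UV /eqP UVH] UD'.
  have := Umax U UD'; rewrite U1 /= size_poly1 /unitary_dvdp -UVH /=.
  rewrite dvdp_mulr// mulrC mulpK ?Aplus_neq0// => /(_ UV) sU.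
  apply: dvdp_Aplus1; rewrite dvdp1 eqn_leq sU lt0n size_poly_eq0.
  exact: Aplus_neq0.
case/andP: UH => /dvdpP_Aplus[V VH] cop; apply: (triv (ugcd D H, V)) => //.
rewrite facE /= Aplus_mulC VH eqxx andbT.
by move: cop; rewrite -{2}VH /= mulpK ?Aplus_neq0.
Qed.

(** The condition on the residues [D] is detected by a sum of Moebius values over
    the factors of [H] that divide [D]; exchanging the summations leaves complete
    character sums. *)
Lemma ramanujan_sumE star G H :
  ramanujan_sum star G H
    = conv (fac star) (fun U => (moebius star U)%:~R) (dvd_norm R[i] G) H.
Proof.
have -> : ramanujan_sum star G H = \sum_(D : {poly_((size H).-1) F})
    \sum_(x <- fac star H | (x.1 : {poly F}) %| D)
      (moebius star x.1)%:~R * add_char R charFp G H D.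
  transitivity (\sum_(D : {poly_((size H).-1) F} |
      `[< forall x, x \in fac star H -> (x.1 : {poly F}) %| D ->
          x.1 = Aplus1 F >]) add_char R charFp G H D).
    rewrite /ramanujan_sum; case: star; apply: eq_bigl => D.
      exact: ugcd_trivial_divisors.
    exact: coprimep_trivial_divisors.
  rewrite big_mkcond; apply: eq_bigr => D _.
  rewrite -mulr_suml -rmorph_sum /= sum_moebius.
  by case: asboolP => _; rewrite ?mul1r ?mul0r.
rewrite (exchange_big_dep predT)//= /conv big_seq [RHS]big_seq.
apply: eq_bigr => -[U V]; rewrite facE => /andP[_ /eqP <-] /=.
by rewrite -mulr_sumr sum_add_char_dvdp.
Qed.

Lemma sum_moebius_eq1 (T : nzRingType) star N :
  \sum_(x <- fac star N) (moebius star x.2)%:~R = (N == Aplus1 F)%:R :> T.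
Proof.
rewrite -(fac_swap star N (fun U _ => (moebius star U)%:~R)).
rewrite -rmorph_sum /= -[RHS](rmorph_nat intr) /=; congr _%:~R.
transitivity (\sum_(x <- fac star N | (x.1 : {poly F}) %| N) moebius star x.1).
  rewrite big_seq [RHS]big_seq_cond; apply: eq_bigl => x; rewrite facE.
  by apply/idP/andP => [xN|[]//]; split=> //; case/andP: xN => _ /eqP <-;
    rewrite dvdp_mulr.
rewrite sum_moebius; congr (nat_of_bool _)%:R; apply/asboolP/eqP => [triv|-> x _].
  apply: (triv (N, Aplus1 F)) => //.
  by rewrite facE /= admC adm1 Aplus_mulC Aplus_mul1 eqxx.
exact: dvdp_Aplus1.
Qed.

(** The identity that drives the expansions.  It follows by inversion from the
    expression of the Ramanujan sum as a convolution with the Moebius function. *)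
Lemma sum_ramanujan_sum star G N :
  \sum_(x <- fac star N) ramanujan_sum star G x.2 = dvd_norm R[i] G N.
Proof.
under eq_bigr do rewrite ramanujan_sumE.
apply: (@conv_inversion _ _ (@Aplus_mul F) (adm star) (Aplus1 F)).
- exact: facE.
- exact: Aplus_mulA.
- exact: adm_assoc.
- exact: Aplus_mul1.
- exact: adm1.
- exact: sum_moebius_eq1.
Qed.

Definition divisor_sum (G : Aplus F) : R :=
  \sum_(D <- fset_set [set D : Aplus F | (D : {poly F}) %| G]) (pnorm D)%:R.

(** Expanding the Ramanujan sums, each divisor of [G] is counted with at most
    [2 ^ omega N] nonzero Moebius values. *)
Lemma sum_normc_ramanujan_sum star (G N : Aplus F) :
  \sum_(x <- fac star N) Normc.normc (ramanujan_sum star G x.2)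
    <= 2 ^+ omega N * divisor_sum G.
Proof.
pose m U : R := `|moebius star U|%:~R.
pose E := dvd_norm R (G : {poly F}).
have E0 U : 0 <= E U by rewrite /E /dvd_norm; case: ifP.
apply: le_trans (_ : conv (fac star) (fun=> 1) (conv (fac star) m E) N <= _).
  rewrite /conv; apply: ler_sum => x _; rewrite mul1r ramanujan_sumE.
  apply: le_trans (ler_normc_sum _ _ _) _; apply: ler_sum => y _.
  rewrite Normc.normcM; apply: ler_pM; rewrite ?normc_ge0//.
    by rewrite -[_%:~R](rmorph_int (real_complex R)) normc_real /m intr_norm.
  by rewrite /E /dvd_norm; case: ifP => _; rewrite ?normc_nat// Normc.normc0.
rewrite (convA (facE star) (@Aplus_mulA F) (adm_assoc star)).
apply: le_trans (_ : \sum_(x <- fac star N) 2 ^+ omega N * E x.2 <= _).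
  rewrite /conv big_seq [leRHS]big_seq; apply: ler_sum => x.
  rewrite facE => /andP[_ /eqP xN]; apply: ler_wpM2r => //.
  apply: le_trans (_ : 2 ^+ omega x.1 <= _).
    under eq_bigr do rewrite mul1r.
    rewrite -(fac_swap star x.1 (fun U _ => m U)) /m -rmorph_sum /=.
    have -> : 2 ^+ omega x.1 = (2 ^+ omega x.1 : int)%:~R :> R by rewrite rmorphXn.
    by rewrite ler_int sum_abs_moebius.
  by rewrite ler_eXn2l ?ltr1n// omegaS// -xN /= dvdp_mulr.
rewrite -mulr_sumr ler_wpM2l ?exprn_ge0//.
pose X := [fset x.2 | x in fac star N]%fset.
have -> : \sum_(x <- fac star N) E x.2 = \sum_(U <- X) E U.
  by rewrite /X big_imfset//; apply: fac_snd_inj.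
pose X' := [fset U in X | (U : {poly F}) %| G]%fset.
have -> : \sum_(U <- X) E U = \sum_(U <- X') (pnorm U)%:R.
  by rewrite /X' -big_fset_condE [RHS]big_mkcond.
apply: ler_sum_fset => // U /=; rewrite !inE /= => /andP[_ UG].
by rewrite in_fset_set ?inE//; apply: finite_divisors.
Qed.

End CharacterSums.
(** * Tuples of monic polynomials *)

Section Tuples.
Variables (F : finFieldType) (k : nat).
Implicit Types (M H N G : tuples k F) (star : bool).

Definition tuple1 : tuples k F := [ffun=> Aplus1 F].

Definition tuple_adm star M H : bool := [forall i, adm star (M i) (H i)].

Lemma tuple_mulA : associative (@tuple_mul F k).
Proof. by move=> L M H; apply/ffunP => i; rewrite !ffunE Aplus_mulA. Qed.

Lemma tuple_mulC : commutative (@tuple_mul F k).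
Proof. by move=> M H; apply/ffunP => i; rewrite !ffunE Aplus_mulC. Qed.

Lemma tuple_mulI H M M' : tuple_mul M H = tuple_mul M' H -> M = M'.
Proof.
move=> /ffunP MM'; apply/ffunP => i; apply: (@Aplus_mulI _ _ _ (H i)).
by have := MM' i; rewrite !ffunE.
Qed.

Lemma tuple_mul1 : left_id tuple1 (@tuple_mul F k).
Proof. by move=> M; apply/ffunP => i; rewrite !ffunE Aplus_mul1. Qed.

Lemma tuple_adm_assoc star L M H :
  tuple_adm star L M && tuple_adm star (tuple_mul L M) H
    = tuple_adm star M H && tuple_adm star L (tuple_mul M H).
Proof.
apply/andP/andP => -[/forallP /= adm1 /forallP /= adm2]; split;
  apply/forallP => i; have := adm_assoc star (L i) (M i) (H i);
  have := adm1 i; have := adm2 i; rewrite !ffunE => -> -> /=;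
  by [move/esym/andP => []|move/andP => []].
Qed.

Lemma tuple_adm1 star M : tuple_adm star tuple1 M.
Proof. by apply/forallP => i; rewrite ffunE adm1. Qed.

Definition tuple_fac star N : {fset tuples k F * tuples k F} :=
  [fset ([ffun i => (h i).1], [ffun i => (h i).2])
     | h : {ffun 'I_k -> (Aplus F * Aplus F)%type} in ffprod (fun i => fac star (N i))]%fset.

Lemma tuple_facE star N x :
  (x \in tuple_fac star N)
    = tuple_adm star x.1 x.2 && (tuple_mul x.1 x.2 == N).
Proof.
apply/imfsetP/andP => /= [[h /ffprodP hN ->]|].
  split; first apply/forallP => i; last apply/eqP/ffunP => i;
    by have := hN i; rewrite facE !ffunE => /andP[? /eqP].
case: x => M H /= [/forallP MH /eqP MHN]; exists [ffun i => (M i, H i)].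
  by apply/ffprodP => i; rewrite ffunE facE MH /= -MHN !ffunE eqxx.
by congr pair; apply/ffunP => i; rewrite !ffunE.
Qed.

Lemma tuple_fac_snd_inj star N :
  {in tuple_fac star N &, injective (fun x => x.2)}.
Proof.
move=> [M H] [M' H']; rewrite !tuple_facE /= => /andP[_ /eqP MH].
move=> /andP[_ /eqP MH'] HH'; congr pair => //.
by apply: (@tuple_mulI H); rewrite MH {1}HH' MH'.
Qed.

Lemma tuple_fac_fst_inj star N :
  {in tuple_fac star N &, injective (fun x => x.1)}.
Proof.
move=> [M H] [M' H']; rewrite !tuple_facE /= => /andP[_ /eqP MH].
move=> /andP[_ /eqP MH'] MM'; congr pair => //.
by apply: (@tuple_mulI M); rewrite tuple_mulC MH {1}MM' tuple_mulC MH'.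
Qed.

Lemma prod_sum_fac (C : comNzRingType) star N
    (phi : 'I_k -> Aplus F -> Aplus F -> C) :
  \prod_(i < k) \sum_(x <- fac star (N i)) phi i x.1 x.2
    = \sum_(x <- tuple_fac star N) \prod_(i < k) phi i (x.1 i) (x.2 i).
Proof.
rewrite prod_sum_ffprod /tuple_fac [RHS]big_imfset/=.
  by apply: eq_bigr => h _; apply: eq_bigr => i _; rewrite !ffunE.
move=> h h' _ _ [/ffunP h1 /ffunP h2]; apply/ffunP => i.
by have := h1 i; have := h2 i; rewrite !ffunE; case: (h i) (h' i) => ? ? [? ?] /= -> ->.
Qed.

Lemma dirichletE (R : realType) (f g : tuples k F -> R[i]) G :
  dirichlet f g G = conv (tuple_fac false) f g G.
Proof.
rewrite /dirichlet fsbig_finite/=; last exact: finite_tuple_divisors.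
rewrite /conv [RHS]big_seq.
transitivity (\sum_(x <- tuple_fac false G | x \in tuple_fac false G)
    f x.1 * g (tuple_div G x.1)).
  rewrite -big_seq -(big_map (fun x : tuples k F * tuples k F => x.1) predT
    (fun D => f D * g (tuple_div G D))).
  apply: perm_big; apply: uniq_perm => [||D]; rewrite ?fset_uniq//.
    by rewrite map_inj_in_uniq ?fset_uniq//; apply: tuple_fac_fst_inj.
  rewrite in_fset_set; last exact: finite_tuple_divisors.
  apply/idP/mapP => [|[[D' E] + ->]]; rewrite inE /=.
    move=> DG; exists (D, tuple_div G D) => //; rewrite tuple_facE.
    apply/andP; split; first exact/forallP.
    by apply/eqP/ffunP => i; rewrite !ffunE Aplus_mulC Aplus_mulKdiv.
  by rewrite tuple_facE => /andP[_ /eqP <-] i; rewrite ffunE /= dvdp_mulr.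
apply: eq_bigr => -[D E]; rewrite tuple_facE => /andP[_ /eqP <-] /=.
congr (_ * g _); apply/ffunP => i.
by rewrite !ffunE Aplus_mulC Aplus_div_mul.
Qed.

(** By distributivity the sum is the product of its analogues for the
    coordinates. *)
Lemma sum_mobius_k_eq1 (R : realType) N :
  \sum_(x <- tuple_fac false N) @mobius_k R F k x.2 = (N == tuple1)%:R.
Proof.
rewrite -(prod_sum_fac false N (fun _ _ U => (mobius U)%:~R)).
under eq_bigr do rewrite (sum_moebius_eq1 R[i] false).
case: eqP => [->|N1]; first by apply: big1 => i _; rewrite ffunE eqxx.
have [i Ni] : exists i, N i != Aplus1 F.
  apply/existsP; apply: contra_notT N1; rewrite negb_exists => /forallP N1.
  by apply/ffunP => i; rewrite ffunE; apply/eqP/negPn/N1.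
by rewrite (bigD1 i)//= (negbTE Ni) mul0r.
Qed.

Lemma sum_dirichlet_mobius_k (R : realType) (f : tuples k F -> R[i]) G :
  \sum_(x <- tuple_fac false G) dirichlet (@mobius_k R F k) f x.2 = f G.
Proof.
under eq_bigr do rewrite dirichletE.
apply: (@conv_inversion _ _ (@tuple_mul F k) (tuple_adm false) tuple1).
- exact: tuple_facE.
- exact: tuple_mulA.
- exact: tuple_adm_assoc.
- exact: tuple_mul1.
- exact: tuple_adm1.
- exact: sum_mobius_k_eq1.
Qed.

End Tuples.

(** * The expansions *)

Section Expansion.
Variables (R : realType) (F : finFieldType) (p : nat) (charFp : p \in [pchar F]).
Variables (k : nat) (f : tuples k F -> R[i]).
Hypothesis f_summable :
  (\esum_(G in [set: tuples k F])
    ((2 ^ (\sum_(i < k) omega (G i)))%:R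
      * Normc.normc (dirichlet (@mobius_k R F k) f G)
      / (tuple_norm G)%:R)%:E < +oo)%E.
Variable star : bool.
Implicit Types (M H N : tuples k F).

Let weight N : R[i] :=
  dirichlet (@mobius_k R F k) f N / (tuple_norm N)%:R.

Definition coef_domain H : set (tuples k F) :=
  if star then tuple_coprime H else setT.

Lemma coef_domainE H M : coef_domain H M <-> tuple_adm star M H.
Proof.
rewrite /coef_domain /tuple_adm /adm; case: star => /=.
  by split=> [MH|/forallP MH]; [apply/forallP|].
by split=> // _; apply/forallP.
Qed.

Lemma pnorm_gt0 (U : Aplus F) : (0 < pnorm U)%N.
Proof. by rewrite /pnorm expn_gt0 (ltn_trans _ (finNzRing_gt1 F)). Qed.

Lemma weighted_sums_bounded : exists B : R, forall X : {fset tuples k F},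
  \sum_(N <- X) 2 ^+ (\sum_(i < k) omega (N i)) * Normc.normc (weight N) <= B.
Proof.
have /esum_ltyP[|B fB] := f_summable.
  by move=> N; rewrite divr_ge0// mulr_ge0// normc_ge0.
exists B => X; apply: le_trans (fB X _) => //; apply: ler_sum => N _.
rewrite /weight Normc.normcM Normc.normcV normc_nat mulrA.
by rewrite -natrX.
Qed.

Lemma coef_summable H : abs_summable (coef_domain H) (coef_term f H).
Proof.
apply: (@sub_abs_summable _ _ _ setT) => //; apply/abs_summableP.
have [B wB] := weighted_sums_bounded; exists B => X _.
apply: le_trans (wB [fset tuple_mul M H | M in X]%fset).
rewrite big_imfset/= => [|M M' _ _]; last exact: tuple_mulI.
apply: ler_sum => M _; rewrite ler_peMl ?normc_ge0//.
by rewrite exprn_ege1// ler1n.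
Qed.

Variable G : tuples k F.

Let pairs : set (tuples k F * tuples k F) := [set x | tuple_adm star x.1 x.2].

Let prod_pair (x : tuples k F * tuples k F) := tuple_mul x.1 x.2.

Let pair_term (x : tuples k F * tuples k F) : R[i] :=
  weight (prod_pair x) *
  \prod_(i < k) ramanujan_sum R charFp star (G i) (x.2 i).

Lemma fibre_prod_pair N : fibre pairs prod_pair N = [set` tuple_fac star N].
Proof.
apply/seteqP; split=> x /=; rewrite tuple_facE.
  by move=> [-> <-]; rewrite eqxx.
by move=> /andP[? /eqP].
Qed.

Lemma fibre_pair_snd H :
  fibre pairs snd H = (fun M => (M, H)) @` coef_domain H.
Proof.
apply/seteqP; split=> [[M H'] /= [MH <-]|_ [M /coef_domainE MH <-]] //.
by exists M => //; apply/coef_domainE.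
Qed.

(** Grouped by the product [N = MH], the absolute values add up to at most the
    weighted sum of the hypothesis times a constant that depends only on [G]. *)
Lemma pair_term_summable : abs_summable pairs pair_term.
Proof.
have [B wB] := weighted_sums_bounded.
pose C := \prod_(i < k) divisor_sum R (G i).
have C0 : 0 <= C by apply: prodr_ge0 => i _; apply: sumr_ge0.
apply/abs_summableP; exists (B * C) => X XS.
pose Y := [fset prod_pair x | x in X]%fset.
have XY x : x \in X -> prod_pair x \in Y by move=> xX; apply: in_imfset.
rewrite -(sum_over_fibres _ XY).
apply: le_trans (ler_wpM2r C0 (wB Y)); rewrite mulr_suml.
apply: ler_sum => N _.
apply: (@le_trans _ _ (\sum_(x <- tuple_fac star N) Normc.normc (pair_term x))).
  apply: ler_sum_fset => [x|x /=]; first exact: normc_ge0.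
  rewrite !inE tuple_facE => /andP[xX /eqP xN]; rewrite (XS x xX) /=.
  exact/eqP.
have -> : \sum_(x <- tuple_fac star N) Normc.normc (pair_term x)
    = \sum_(x <- tuple_fac star N) Normc.normc (weight N) *
      \prod_(i < k) Normc.normc (ramanujan_sum R charFp star (G i) (x.2 i)).
  apply: eq_big_seq => x; rewrite tuple_facE => /andP[_ /eqP xN].
  by rewrite /pair_term /prod_pair xN Normc.normcM normc_prod.
rewrite -mulr_sumr [leRHS]mulrAC [leRHS]mulrC ler_wpM2l ?normc_ge0//.
rewrite -(prod_sum_fac star N (fun i _ U =>
  Normc.normc (ramanujan_sum R charFp star (G i) U))).
rewrite -prodrXr -big_split/=; apply: ler_prod => i _.
rewrite sum_normc_ramanujan_sum andbT; apply: sumr_ge0 => x _.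
exact: normc_ge0.
Qed.

Lemma sums_to_fibre_prod_pair N :
  sums_to (fibre pairs prod_pair N) pair_term
    (weight N * \prod_(i < k) dvd_norm R[i] (G i) (N i)).
Proof.
have -> : weight N * \prod_(i < k) dvd_norm R[i] (G i) (N i)
    = \sum_(x <- tuple_fac star N) pair_term x.
  under eq_bigr do rewrite -(sum_ramanujan_sum R charFp star).
  rewrite (prod_sum_fac star N (fun i _ U => ramanujan_sum R charFp star (G i) U)).
  rewrite mulr_sumr; apply: eq_big_seq => x; rewrite tuple_facE.
  by move=> /andP[_ /eqP xN]; rewrite /pair_term /prod_pair xN.
rewrite fibre_prod_pair; apply: sums_to_finite_support => // x /= ->.
by [].
Qed.

Lemma sums_to_fibre_snd H :
  sums_to (fibre pairs snd H) pair_term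
    (csum (coef_domain H) (coef_term f H)
     * \prod_(i < k) ramanujan_sum R charFp star (G i) (H i)).
Proof.
rewrite fibre_pair_snd; apply: (@sums_to_image _ _ _ _ fst) => //.
rewrite mulrC; set c := \prod_(i < k) _.
have := sums_toZ c (abs_summable_csum (coef_summable H)).
by apply: eq_sums_to => M _; rewrite mulrC.
Qed.

(** Only the [N] dividing [G] contribute, with the values of the Moebius
    transform of [f], which add up to [f G]. *)
Lemma sums_to_weight_dvd_norm :
  sums_to setT (fun N => weight N * \prod_(i < k) dvd_norm R[i] (G i) (N i)) (f G).
Proof.
set v := (fun N => _).
pose Z := [fset x.2 | x in tuple_fac false G]%fset.
rewrite (_ : f G = \sum_(N <- Z) v N).
  apply: sums_to_finite_support => // N _ NZ; rewrite /v.
  have [i Ni] : exists i, ~~ ((N i : {poly F}) %| G i).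
    apply/existsP; apply: contraNT NZ; rewrite negb_exists => /forallP NG.
    apply/imfsetP; exists (tuple_div G N, N) => //=; rewrite tuple_facE.
    apply/andP; split; first exact/forallP.
    apply/eqP/ffunP => i; rewrite !ffunE Aplus_mulKdiv//.
    exact/negPn/NG.
  by rewrite (bigD1 i)//= /dvd_norm (negbTE Ni) mul0r mulr0.
rewrite -[LHS]sum_dirichlet_mobius_k.
have -> : \sum_(N <- Z) v N = \sum_(x <- tuple_fac false G) v x.2.
  by rewrite /Z big_imfset//; apply: tuple_fac_snd_inj.
apply: eq_big_seq => x; rewrite tuple_facE => /andP[_ /eqP xG].
rewrite /v /weight (eq_bigr (fun i => (pnorm (x.2 i))%:R)) => [|i _].
  rewrite -natr_prod divfK// pnatr_eq0 -lt0n.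
  by apply: prodn_gt0 => i; apply: pnorm_gt0.
by rewrite /dvd_norm -xG ffunE /= dvdp_mull.
Qed.

(** Both groupings of the pairs [(M, H)], by [MH] and by [H], have the sum of the
    whole family; the first gives [f G] and the second is the expansion. *)
Lemma ramanujan_expansion :
  let term H := csum (coef_domain H) (coef_term f H)
    * \prod_(i < k) ramanujan_sum R charFp star (G i) (H i) in
  abs_summable setT term /\ sums_to setT term (f G).
Proof.
move=> term; split.
  exact: abs_summable_fibres pair_term_summable sums_to_fibre_snd.
have [s ss] := abs_summable_sums_to pair_term_summable.
have := sums_to_fibres sums_to_fibre_prod_pair ss.
move=> /sums_to_unique/(_ sums_to_weight_dvd_norm) <-.
exact: sums_to_fibres sums_to_fibre_snd ss.
Qed.

End Expansion.

Theorem theorem1p7 (R : realType) (F : finFieldType) (p : nat)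
    (charFp : p \in [pchar F]) (k : nat) (k_gt0 : (0 < k)%N)
    (f : tuples k F -> R[i]) (f_neq0 : exists G, f G != 0)
    (f_summable :
      (\esum_(G in [set: tuples k F])
        ((2 ^ (\sum_(i < k) omega (G i)))%:R
          * Normc.normc (dirichlet (@mobius_k R F k) f G)
          / (tuple_norm G)%:R)%:E < +oo)%E) :
  [/\ forall H : tuples k F, abs_summable setT (coef_term f H),
      forall H : tuples k F,
        abs_summable (tuple_coprime H) (coef_term f H)
    & forall G : tuples k F,
      let term (H : tuples k F) :=
        ramanujan_coef f H * \prod_(i < k) eta R charFp (G i) (H i) in
      let term_star (H : tuples k F) :=
        ramanujan_coef_star f H * \prod_(i < k) eta_star R charFp (G i) (H i) in
      [/\ abs_summable setT term, sums_to setT term (f G),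
          abs_summable setT term_star & sums_to setT term_star (f G)]].
Proof.
split=> [H|H|G term term_star].
- exact: (coef_summable f_summable false H).
- exact: (coef_summable f_summable true H).
- have [sum1 sum2] := ramanujan_expansion charFp f_summable false G.
  by have [] := ramanujan_expansion charFp f_summable true G.
Qed.
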